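(* Let $f,\hat f$ be spectral densities on $\Lambda$ such that: 1) $f,\hat f\in B^-$; 2) there are points $-\pi<\lambda_1<\lambda_2<\dots<\lambda_k\le\pi$ ($k\in\mathbb N$) with $\lim_{\lambda\to\lambda_j}f(\lambda)=\lim_{\lambda\to\lambda_j}\hat f(\lambda)=0$ for $j=1,\dots,k$; 3) $\lim_{\lambda\to\lambda_j}\hat f(\lambda)/f(\lambda)=c_j>0$ for $j=1,\dots,k$; 4) for every $\delta>0$ such that the neighborhoods $O_\delta(\lambda_j)=\{\lambda\in\Lambda:|\lambda-\lambda_j|<\delta\}$ do not contain the neighbouring zeros $\lambda_{j\pm1}$, there is $m_\delta>0$ with $f(\lambda)\ge m_\delta$ and $\hat f(\lambda)\ge m_\delta$ for almost all $\lambda\notin\bigcup_{j=1}^kO_\delta(\lambda_j)$. Then: (a) $h:=\hat f/f\in B_+^-$; (b) either $G(f)=G(\hat f)=0$ or both $G(f)>0$ and $G(\hat f)>0$ (the two processes are both deterministic or both nondeterministic); (c) if one of $f,\hat f$ belongs to $\mathcal F$, so does the other, and $$\lim_{n\to\infty}\frac{\sigma_n^2(\hat f)}{\sigma_n^2(f)}=G(h)>0.$$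
   Context: $\Lambda=[-\pi,\pi]$. Spectral density: $f\ge0$, $f\in L^1(\Lambda)$, positive on a set of positive measure. $G(h)=\exp\{\frac1{2\pi}\int_\Lambda\ln h\,d\lambda\}$ if $\ln h\in L^1(\Lambda)$, else $0$. $\sigma_n^2(f)=\min_{c_1,\dots,c_n\in\mathbb C}\int_\Lambda|1-\sum_{k=1}^n c_ke^{-ik\lambda}|^2f(\lambda)\,d\lambda$, $\sigma_n(f)=\sqrt{\sigma_n^2(f)}$. $\mathcal F=\{f\in L^1(\Lambda): f\ge0,\ G(f)=0,\ \lim_{n}\sigma_{n+1}(f)/\sigma_n(f)=1\}$. $B$ = nonnegative Riemann integrable functions on $\Lambda$; $B^-=\{h\in B: h\le M\text{ for some constant }M>0\}$; $B_+^-=\{h\in B: m\le h\le M\text{ for some constants }0<m\le M\}$.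
   Formalization: In (a), h = f̂/f is shown to coincide almost everywhere on Λ with a function in B_+^-, instead of lying in B_+^- pointwise: condition 4 holds only a.e., so f may vanish or be arbitrarily small on a null set, where h is undefined or unbounded. *)

(* Defs.v *)
From HB Require Import structures.
From Stdlib Require Import Rdefinitions RiemannInt.
From mathcomp Require Import all_boot all_order all_algebra.
From mathcomp Require Import all_classical all_reals all_analysis.
From mathcomp Require Import Rstruct Rstruct_topology.

Set Implicit Arguments.
Unset Strict Implicit.
Unset Printing Implicit Defensive.
Import Order.TTheory GRing.Theory Num.Theory.
Import numFieldNormedType.Exports.

Local Open Scope classical_set_scope.
Local Open Scope ring_scope.

Definition leb := (@lebesgue_measure R).

Definition Lam : set R := `[(- pi)%R, pi%R].

Definition nonneg_L1 (f : R -> R) : Prop :=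
  (forall x, Lam x -> 0 <= f x) /\ leb.-integrable Lam (EFin \o f).

Definition spectral_density (f : R -> R) : Prop :=
  nonneg_L1 f /\ (0 < leb (Lam `&` [set x | (0 < f x)%R]))%E.

Definition lnE (h : R -> R) (x : R) : \bar R :=
  if 0 < h x then (ln (h x))%:E else -oo%E.

Definition G (h : R -> R) : R :=
  if `[< leb.-integrable Lam (lnE h) >]
  then expR ((2 * pi)^-1 * fine (\int[leb]_(x in Lam) lnE h x))
  else 0.

(* |1 - sum_{k=1}^n c_k e^{-i k x}|^2 with c_k = a k + i b k, written out as
   (real part)^2 + (imaginary part)^2, using
   c_k e^{-ikx} = (a_k cos kx + b_k sin kx) + i (b_k cos kx - a_k sin kx). *)
Definition trig_err2 (n : nat) (a b : nat -> R) (x : R) : R :=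
  (1 - \sum_(1 <= k < n.+1) (a k * cos (k%:R * x) + b k * sin (k%:R * x))) ^+ 2
  + (\sum_(1 <= k < n.+1) (b k * cos (k%:R * x) - a k * sin (k%:R * x))) ^+ 2.

Definition sigma2 (f : R -> R) (n : nat) : R :=
  fine (ereal_inf [set (\int[leb]_(x in Lam) (trig_err2 n ab.1 ab.2 x * f x)%:E)%E
                   | ab in [set: (nat -> R) * (nat -> R)]]).

Definition sigma (f : R -> R) (n : nat) : R := Num.sqrt (sigma2 f n).

Definition classF (f : R -> R) : Prop :=
  nonneg_L1 f /\ G f = 0 /\
  (fun n => sigma f n.+1 / sigma f n) @ \oo --> (1 : R).

Definition Riemann_int_Lam (h : R -> R) : Prop :=
  inhabited (Riemann_integrable h (- pi) pi).

Definition classB (h : R -> R) : Prop :=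
  (forall x, Lam x -> 0 <= h x) /\ Riemann_int_Lam h.

Definition classBminus (h : R -> R) : Prop :=
  classB h /\ exists M : R, 0 < M /\ forall x, Lam x -> h x <= M.

Definition classBplusminus (h : R -> R) : Prop :=
  classB h /\ exists m M : R, 0 < m /\ m <= M /\
                              forall x, Lam x -> m <= h x <= M.

Definition lim_in_Lam (g : R -> R) (a l : R) : Prop :=
  g x @[x --> within Lam a^'] --> l.

(* Main.v *)
(** The minimum defining [sigma2] runs over polynomials [P] with [P(0) = 1], of
    degree at most [n], evaluated at [z = e^(-ix)].  If [p(0) = 1], [deg p = d] and
    [c |p(z)|^2 f <= fh] a.e., then replacing [P] by [P p] gives
    [c sigma2 f (n + d) <= sigma2 fh n].  When [sigma f n.+1 / sigma f n] tends to
    [1] the shift by [d] is harmless in the limit, so it suffices to find such [p]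
    with [c |p|^2 <= h] and [c] close to [G h]; the same for [1 / h] bounds the
    ratio from above.

    For this, take a trigonometric polynomial [u = a + 2 Re A(z) <= ln h] with
    [A(0) = 0] and mean [a] close to that of [ln h]; it exists because [h] is
    Riemann integrable.  Then [p = (1 + A / L)^L] works for large [L], since
    [|1 + A / L|^2 <= exp (2 Re A / L + |A|^2 / L^2)].  This avoids both the
    Fejer-Riesz factorization and outer functions.

    The ratio [fh / f] may be badly behaved on a null set, so its Riemann integrable
    representative is glued from the truncations [fh / max (f, m_n)] on the
    complements of shrinking neighbourhoods of the zeros. *)
Require Import Defs.
From HB Require Import structures.
From Stdlib Require Import Rdefinitions RIneq RList RiemannInt_SF RiemannInt.
From mathcomp Require Import all_boot all_order all_algebra.
From mathcomp Require Import all_classical all_reals all_analysis.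
From mathcomp Require Import Rstruct Rstruct_topology measurable_realfun complex ring lra.
Import Order.TTheory GRing.Theory Num.Theory.
Import numFieldNormedType.Exports.
Local Open Scope classical_set_scope.
Local Open Scope ring_scope.
(* Otherwise arguments of type [R] would be parsed in [R_scope]. *)
Bind Scope ring_scope with R.
Local Notation Re := complex.Re.
Local Notation Im := complex.Im.

(** * Step functions and Riemann integrability *)

(** A relation instead of the bundled [StepFun] of Stdlib: the subdivision stays hidden and the
    integral is a plain real number. *)
Definition has_step_int (a b : R) (f : R -> R) (I : R) : Prop :=
  exists pr : IsStepFun f a b, RiemannInt_SF (mkStepFun pr) = I.

Lemma step_int_cst (a b c : R) : has_step_int a b (fun=> c) (c * (b - a)).
Proof. by exists (StepFun_P4 a b c); rewrite StepFun_P18. Qed.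

Lemma step_int_lin (a b l I J : R) (f g : R -> R) :
  has_step_int a b f I -> has_step_int a b g J ->
  has_step_int a b (fun x => f x + l * g x) (I + l * J).
Proof.
move=> [pf <-] [pg <-].
exists (StepFun_P28 l (mkStepFun pf) (mkStepFun pg)).
exact: StepFun_P30.
Qed.

Lemma step_int_le (a b I J : R) (f g : R -> R) : a <= b ->
  (forall x, a < x < b -> f x <= g x) ->
  has_step_int a b f I -> has_step_int a b g J -> I <= J.
Proof.
move=> ab fg [pf <-] [pg <-]; apply/RleP/StepFun_P37; first exact/RleP.
by move=> x [/RltP ax /RltP xb]; apply/RleP/fg; rewrite ax.
Qed.

Lemma Rmid_open (u v : R) : Rlt u v -> open_interval u v (Rdiv (Rplus u v) (IZR 2)).
Proof.
move=> /RltP uv; rewrite RdivE RplusE; change (IZR 2) with (2 : R).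
by split; apply/RltP; [rewrite midf_lt|rewrite midf_lt].
Qed.

(** On each open piece of the common refinement both functions are constant, so [Phi] may be
    arbitrary. In return nothing is said about the value of the integral. *)
Lemma step_int_map2 (Phi : R -> R -> R) (a b I J : R) (f g : R -> R) :
  has_step_int a b f I -> has_step_int a b g J ->
  exists K, has_step_int a b (fun x => Phi (f x) (g x)) K.
Proof.
move=> [[lf sf] _] [[lg sg] _].
have [x0 [H0 [H1 [H2 [H3 H4]]]]] := StepFun_P23 sf sg.
have [x1 [_ [_ [_ [_ H9]]]]] := StepFun_P25 sf sg.
set l1 := cons_ORlist lf lg in H0 H1 H2 H3 H4 H9.
have pr : IsStepFun (fun x => Phi (f x) (g x)) a b.
  (* [FF] lists the values at the midpoints of the pieces of [l1]. *)
  exists l1, (FF l1 (fun x => Phi (f x) (g x))); do 4?split=> //.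
    by apply: StepFun_P20; rewrite H3; exact: PeanoNat.Nat.lt_0_succ.
  move=> i Hi x Hx; rewrite (H9 _ Hi _ Hx) (H4 _ Hi _ Hx).
  have nl1 : l1 <> nil by move=> E; rewrite E in Hi; case: (PeanoNat.Nat.nlt_0_r _ Hi).
  have [r [r0 E]] := RList_P19 _ nl1.
  move: Hi Hx H4 H9; rewrite E => Hi Hx H4 H9; rewrite /FF RList_P12; last first.
    by rewrite RList_P14; apply: Hi.
  change (Phi (pos_Rl x0 i) (pos_Rl x1 i) =
    Phi (f (pos_Rl (mid_Rlist (cons r r0) r) (S i))) (g (pos_Rl (mid_Rlist (cons r r0) r) (S i)))).
  rewrite RList_P13 //.
  set m := (X in f X).
  have Hm : open_interval (pos_Rl (r :: r0)%list i) (pos_Rl (r :: r0)%list i.+1) m.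
    by case: Hx => h1 h2; apply: Rmid_open; apply: Rlt_trans h1 h2.
  by rewrite (H4 _ Hi _ Hm) (H9 _ Hi _ Hm).
by eexists; exists pr.
Qed.

Lemma step_int_opp (a b I : R) (f : R -> R) :
  has_step_int a b f I -> has_step_int a b (fun x => - f x) (- I).
Proof.
move=> hf; have := step_int_lin a b (-1) _ _ _ _ (step_int_cst a b 0) hf.
rewrite mul0r add0r mulN1r.
by under eq_fun do rewrite add0r mulN1r.
Qed.

Lemma step_int_add (a b I J : R) (f g : R -> R) :
  has_step_int a b f I -> has_step_int a b g J ->
  has_step_int a b (fun x => f x + g x) (I + J).
Proof.
move=> hf hg; have := step_int_lin a b 1 _ _ _ _ hf hg.
by rewrite mul1r; under eq_fun do rewrite mul1r.
Qed.

Lemma step_int_scale (a b l I : R) (f : R -> R) :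
  has_step_int a b f I -> has_step_int a b (fun x => l * f x) (l * I).
Proof.
move=> hf; have := step_int_lin a b l _ _ _ _ (step_int_cst a b 0) hf.
by rewrite mul0r add0r; under eq_fun do rewrite add0r.
Qed.

Lemma step_int_couple (a b : R) (f : R -> R) l lf : a <= b ->
  adapted_couple f a b l lf -> has_step_int a b f (Int_SF lf l).
Proof.
move=> ab H; have pr : IsStepFun f a b by exists l, lf.
exists pr; rewrite /RiemannInt_SF; case: Rle_dec => [h|/RleP]; last by rewrite ab.
exact: (StepFun_P17 (StepFun_P1 (mkStepFun pr)) H).
Qed.

Lemma step_int_ex_couple (a b I : R) (f : R -> R) : a <= b ->
  has_step_int a b f I -> exists l lf, adapted_couple f a b l lf /\ I = Int_SF lf l.
Proof.
move=> ab [pr <-]; have H := StepFun_P1 (mkStepFun pr).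
exists (subdivision (mkStepFun pr)), (subdivision_val (mkStepFun pr)).
split; first exact: H.
by rewrite /RiemannInt_SF; case: Rle_dec => [h|/RleP] //; rewrite ab.
Qed.

Lemma step_int_indic (a b p q : R) : a <= p -> p <= q -> q <= b ->
  has_step_int a b (fun x => (p <= x <= q)%R%:R) (q - p).
Proof.
move=> ap pq qb; have ab : a <= b by rewrite (le_trans ap)// (le_trans pq).
have := @step_int_couple a b (fun x : R => (p <= x <= q)%R%:R) (cons a (cons p (cons q (cons b nil)))) (cons 0 (cons 1 (cons 0 nil))) ab.
rewrite /= !RmultE !RplusE !RminusE; set s := (X in has_step_int _ _ _ X).
have -> : s = q - p by rewrite /s -[IZR Z0]/(0 : R); ring.
apply; do 4?split => //=.
- move=> i Hi; do 4?[case: i Hi => [|i] Hi /=; first exact/RleP]; case: (PeanoNat.Nat.nlt_0_r i).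
  by do 3!apply/PeanoNat.Nat.succ_lt_mono.
- by rewrite RminE min_l.
- by rewrite RmaxE max_r.
- move=> i Hi; do 3?[case: i Hi => [|i] Hi].
  + by move=> x [/RltP x1 /RltP x2] /=; rewrite leNgt x2.
  + by move=> x [/RltP x1 /RltP x2] /=; rewrite !ltW.
  + by move=> x [/RltP x1 /RltP x2] /=; rewrite [x <= q]leNgt x1 andbF.
  + by case: (PeanoNat.Nat.nlt_0_r i); do 3!apply/PeanoNat.Nat.succ_lt_mono.
Qed.

(** The propositional form of [Riemann_integrable], which lives in [Type]. Only an upper bound on
    [J] is asked for. *)
Definition RI (a b : R) (h : R -> R) : Prop :=
  forall e : R, 0 < e -> exists phi psi I J,
    [/\ has_step_int a b phi I, has_step_int a b psi J, J < e &
        forall x, a <= x <= b -> `|h x - phi x| <= psi x].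

Lemma RI_Riemann_integrable (a b : R) (h : R -> R) : a <= b ->
  inhabited (Riemann_integrable h a b) <-> RI a b h.
Proof.
move=> ab; split.
  move=> [rh] e e0; have [phi [psi [H1 H2]]] := rh (mkposreal e (RltP e0)).
  exists phi, psi, (RiemannInt_SF phi), (RiemannInt_SF psi); split.
  - by exists (pre phi); case: phi {H1}.
  - by exists (pre psi); case: psi {H1 H2}.
  - by move/RltP : H2 => /=; rewrite RabsE; apply: le_lt_trans; rewrite ler_norm.
  - move=> x /andP[ax xb]; rewrite -RabsE; apply/RleP; apply: H1.
    by rewrite RminE RmaxE min_l// max_r//; split; apply/RleP.
move=> H; apply/inhabits => e.
have e0 : 0 < pos e by apply/RltP; exact: cond_pos.
have /cid[phi /cid[psi /cid[I /cid[J [h1 h2 h3 h4]]]]] := H _ e0.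
have [p1 p1E] := cid h1; have [p2 p2E] := cid h2.
exists (mkStepFun p1), (mkStepFun p2); split.
  move=> t; rewrite RminE RmaxE min_l// max_r// => -[/RleP at_ /RleP tb].
  by apply/RleP; rewrite RabsE; apply: h4; rewrite at_.
(* [J] is nonnegative because [psi] dominates an absolute value. *)
rewrite p2E; apply/RltP; rewrite RabsE ger0_norm//.
rewrite -[0](mul0r (b - a)); apply: (step_int_le _ _ _ _ _ _ ab _ (step_int_cst a b 0) h2).
by move=> x /andP[/ltW ax /ltW xb]; rewrite (le_trans _ (h4 x _))// ax.
Qed.

Lemma RI_lipschitz2 (Phi : R -> R -> R) (K a b : R) (f g : R -> R) : 0 <= K ->
  (forall x y x' y', `|Phi x y - Phi x' y'| <= K * (`|x - x'| + `|y - y'|)) ->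
  RI a b f -> RI a b g -> RI a b (fun x => Phi (f x) (g x)).
Proof.
move=> K0 lip rf rg e e0.
(* The divisor has [K + 1] because [K] may be 0. *)
have e1 : 0 < e / (2 * (K + 1)) by rewrite divr_gt0// mulr_gt0// ltr_wpDl.
have [p1 [s1 [I1 [J1 [a1 b1 c1 d1]]]]] := rf _ e1.
have [p2 [s2 [I2 [J2 [a2 b2 c2 d2]]]]] := rg _ e1.
have [L hL] := step_int_map2 Phi _ _ _ _ _ _ a1 a2.
exists (fun x => Phi (p1 x) (p2 x)), (fun x => K * (s1 x + s2 x)), L, (K * (J1 + J2)); split => //.
- exact/step_int_scale/step_int_add.
- have K1 : 0 < K + 1 by lra.
  apply: (@le_lt_trans _ _ (K * (e / (K + 1)))).
    rewrite ler_wpM2l//.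
    have : J1 + J2 <= e / (2 * (K + 1)) + e / (2 * (K + 1)) by lra.
    move/le_trans; apply; rewrite le_eqVlt; apply/orP; left; apply/eqP; field; lra.
  by rewrite mulrCA -ltr_pdivlMl// mulVf ?gt_eqF// ltr_pdivrMr// mul1r ltrDl.
- move=> x xab; apply: (le_trans (lip _ _ _ _)).
  by rewrite ler_wpM2l// lerD// ?d1 ?d2.
Qed.

Lemma RI_lipschitz (Phi : R -> R) (K a b : R) (f : R -> R) : 0 <= K ->
  (forall x x', `|Phi x - Phi x'| <= K * `|x - x'|) ->
  RI a b f -> RI a b (fun x => Phi (f x)).
Proof.
move=> K0 lip rf; apply: (RI_lipschitz2 (fun x _ => Phi x) K _ _ f f K0) => // x y x' y'.
by apply: le_trans (lip _ _) _; rewrite ler_wpM2l// lerDl.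
Qed.

Lemma RI_cst (a b c : R) : a <= b -> RI a b (fun=> c).
Proof.
move=> ab e e0; exists (fun=> c), (fun=> 0), (c * (b - a)), (0 * (b - a)).
split=> //; try exact: step_int_cst; first by rewrite mul0r.
by move=> x _; rewrite subrr normr0.
Qed.

Lemma RI_ext (a b : R) (f g : R -> R) : (forall x, a <= x <= b -> f x = g x) ->
  RI a b f -> RI a b g.
Proof.
move=> fg rf e /rf [p [s [I [J [h1 h2 h3 h4]]]]]; exists p, s, I, J; split => // x xab.
by rewrite -fg// h4.
Qed.

(** Case distinction along a step set, written arithmetically so that [step_int_map2] applies. The
    sum of the two error functions works on either side, both being nonnegative. *)
Lemma RI_if (a b : R) (chi u v : R -> R) :
  (exists I, has_step_int a b chi I) ->
  (forall x, chi x = 0 \/ chi x = 1) ->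
  RI a b u -> RI a b v -> RI a b (fun x => chi x * u x + (1 - chi x) * v x).
Proof.
move=> [Ic hc] chi01 ru rv e e0.
have [p1 [s1 [I1 [J1 [a1 b1 c1 d1]]]]] := ru _ (divr_gt0 e0 (ltr0Sn R 1)).
have [p2 [s2 [I2 [J2 [a2 b2 c2 d2]]]]] := rv _ (divr_gt0 e0 (ltr0Sn R 1)).
have [K1 h1] := step_int_map2 (fun c x => c * x) _ _ _ _ _ _ hc a1.
have [K2 h2] := step_int_map2 (fun c x => (1 - c) * x) _ _ _ _ _ _ hc a2.
exists (fun x => chi x * p1 x + (1 - chi x) * p2 x), (fun x => s1 x + s2 x), (K1 + K2), (J1 + J2).
split; [exact: step_int_add|exact: step_int_add|lra|].
move=> x xab; have := d1 x xab; have := d2 x xab.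
case: (chi01 x) => ->; rewrite ?subrr ?subr0 !mul0r !mul1r ?add0r ?addr0 => k1 k2.
  by apply: (le_trans k1); rewrite lerDr (le_trans _ k2).
by apply: (le_trans k2); rewrite lerDl (le_trans _ k1).
Qed.

Lemma RI_squeeze (a b : R) (h : R -> R) :
  (forall e : R, 0 < e -> exists l w J,
    [/\ RI a b l, has_step_int a b w J, J < e &
        forall x, a <= x <= b -> `|h x - l x| <= w x]) -> RI a b h.
Proof.
move=> H e e0.
have [l [w [J [rl hw Je hl]]]] := H _ (divr_gt0 e0 (ltr0Sn R 1)).
have [p [s [I' [J' [a1 b1 c1 d1]]]]] := rl _ (divr_gt0 e0 (ltr0Sn R 1)).
exists p, (fun x => w x + s x), I', (J + J'); split => //; [exact: step_int_add|lra|].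
move=> x xab; have := hl x xab; have := d1 x xab => h1 h2.
by rewrite (le_trans (ler_distD (l x) _ _))// lerD.
Qed.

(** * Real trigonometric polynomials *)

(** The squared modulus with values in [R]; the norm of [R[i]] takes its values in [R[i]]. *)
Definition csq (w : R[i]) : R := Re w ^+ 2 + Im w ^+ 2.

Definition zeta (x : R) : R[i] := Complex (cos x) (- sin x).

Lemma csq_ge0 (w : R[i]) : 0 <= csq w.
Proof. by rewrite addr_ge0// sqr_ge0. Qed.

Lemma csq1 : csq 1 = 1.
Proof. by rewrite /csq /= expr1n expr0n addr0. Qed.

Lemma csqM (v w : R[i]) : csq (v * w) = csq v * csq w.
Proof. by case: v w => [a b] [c d]; rewrite /csq /=; ring. Qed.

Lemma csqX (w : R[i]) (n : nat) : csq (w ^+ n) = csq w ^+ n.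
Proof. by elim: n => [|n IH]; rewrite ?expr0 ?csq1// !exprS csqM IH. Qed.

Lemma ReD (v w : R[i]) : Re (v + w) = Re v + Re w.
Proof. by case: v w => [a b] [c d]. Qed.

Lemma ImD (v w : R[i]) : Im (v + w) = Im v + Im w.
Proof. by case: v w => [a b] [c d]. Qed.

Lemma Re_sum (I : Type) (r : seq I) (F : I -> R[i]) :
  Re (\sum_(i <- r) F i) = \sum_(i <- r) Re (F i).
Proof. exact: (big_morph _ ReD erefl). Qed.

Lemma Im_sum (I : Type) (r : seq I) (F : I -> R[i]) :
  Im (\sum_(i <- r) F i) = \sum_(i <- r) Im (F i).
Proof. exact: (big_morph _ ImD erefl). Qed.

Lemma zetaX (x : R) (n : nat) :
  zeta x ^+ n = Complex (cos (n%:R * x)) (- sin (n%:R * x)).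
Proof.
elim: n => [|n IH]; first by rewrite expr0 mul0r cos0 sin0 oppr0.
rewrite exprS IH -natr1 mulrDl mul1r trigo.cosD trigo.sinD.
by apply/eqP; rewrite eq_complex /=; apply/andP; split; apply/eqP; ring.
Qed.

Lemma Re_mul_zetaX (w : R[i]) (x : R) (n : nat) :
  Re (w * zeta x ^+ n) = Re w * cos (n%:R * x) + Im w * sin (n%:R * x).
Proof. by rewrite zetaX; case: w => [a b] /=; ring. Qed.

Lemma Im_mul_zetaX (w : R[i]) (x : R) (n : nat) :
  Im (w * zeta x ^+ n) = Im w * cos (n%:R * x) - Re w * sin (n%:R * x).
Proof. by rewrite zetaX; case: w => [a b] /=; ring. Qed.

(** Every real trigonometric polynomial is the real part of an ordinary polynomial on the unit
    circle. The real part of its constant coefficient is the mean of [u], as [integral_trig]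
    confirms. *)
Definition trig_mean (u : R -> R) (m : R) : Prop :=
  exists A : {poly R[i]}, (forall x, u x = Re A.[zeta x]) /\ Re A`_0 = m.

Lemma trig_cst (c : R) : trig_mean (fun=> c) c.
Proof. by exists (Complex c 0)%:P; split => [x|]; rewrite ?hornerC ?coefC. Qed.

Lemma trig_add (u v : R -> R) (m n : R) : trig_mean u m -> trig_mean v n ->
  trig_mean (fun x => u x + v x) (m + n).
Proof.
move=> [A [uA <-]] [B [vB <-]]; exists (A + B); split=> [x|].
  by rewrite hornerD ReD uA vB.
by rewrite coefD ReD.
Qed.

Lemma trig_scale (c : R) (u : R -> R) (m : R) : trig_mean u m ->
  trig_mean (fun x => c * u x) (c * m).
Proof.
have Rec (w : R[i]) : Re (Complex c 0 * w) = c * Re w by case: w => a b /=; ring.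
move=> [A [uA <-]]; exists ((Complex c 0)%:P * A); split=> [x|].
  by rewrite hornerM hornerC Rec uA.
by rewrite coefCM Rec.
Qed.

(* [z^-1] is the conjugate of [z] on the unit circle, so multiplying by
   [cos (x - t)], the real part of [e^(it) z], raises the degree by one, and the
   only negative power that it creates comes from the constant coefficient. *)
Lemma trig_mul_cos (t : R) (u : R -> R) (m : R) : trig_mean u m ->
  exists n, trig_mean (fun x => u x * cos (x - t)) n.
Proof.
move=> [A [uA _]].
pose w : R[i] := Complex (cos t) (sin t); pose w' : R[i] := Complex (cos t) (- sin t).
pose h : R[i] := Complex 2^-1 0.
have [B [b AE]] : exists B b, A = B * 'X + b%:P.
  elim/poly_ind : A {uA} => [|B b _]; first by exists 0, 0; rewrite mul0r addr0.
  by exists B, b.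
pose D : {poly R[i]} := h%:P * (A * w%:P * 'X + B * w'%:P + (conjc b * w)%:P * 'X).
exists (Re D`_0); exists D; split=> // x.
rewrite uA /D AE !hornerE; case: (B.[zeta x]) => p q; case: b {AE D} => r s.
rewrite cosB /zeta /=.
have /(congr1 (fun z => z * (p * cos t + q * sin t))) := cos2Dsin2 x.
rewrite mul1r => cs; apply/eqP; rewrite -subr_eq0; apply/eqP.
transitivity (2^-1 * ((cos x ^+ 2 + sin x ^+ 2) * (p * cos t + q * sin t) - (p * cos t + q * sin t))); last first.
  by rewrite cs subrr mulr0.
by field.
Qed.

Lemma trig_horner_cos (t : R) (p : {poly R}) :
  exists m, trig_mean (fun x => p.[cos (x - t)]) m.
Proof.
elim/poly_ind : p => [|p c [m hm]].
  by exists 0; under eq_fun do rewrite horner0; exact: trig_cst.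
have [n hn] := trig_mul_cos t _ _ hm.
exists (n + c); under eq_fun do rewrite hornerMXaddC.
exact: trig_add hn (trig_cst c).
Qed.

Lemma trig_opp (u : R -> R) (m : R) : trig_mean u m -> trig_mean (fun x => - u x) (- m).
Proof. by move=> /(trig_scale (-1)); rewrite mulN1r; under eq_fun do rewrite mulN1r. Qed.

Lemma integral_cosn (R : realType) (k : nat) :
  (\int[lebesgue_measure]_(x in `[(- pi)%R, (pi : R)%R]) (cos (k%:R * x))%:E)%E = (((2 : R) * pi) *+ (k == 0)%N)%:E.
Proof.
have pipi : - pi < pi :> R by have := pi_gt0 R; lra.
case: k => [|k].
  under eq_integral do rewrite mul0r cos0.
  rewrite integral_cst//= lebesgue_measure_itv/= lte_fin pipi -EFinB -EFinM.
  by congr EFin; rewrite mulr1n; ring.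
have k0 : k.+1%:R != 0 :> R by rewrite pnatr_eq0.
have dF (x : R) : is_derive x 1 (fun y : R => k.+1%:R^-1 * sin (k.+1%:R * y)) (cos (k.+1%:R * x)).
  by apply: is_derive_eq; rewrite /GRing.scale/=; field.
have cF : continuous (fun y : R => k.+1%:R^-1 * sin (k.+1%:R * y)).
  by move=> x; apply/differentiable_continuous/derivable1_diffP; exact: ex_derive.
rewrite (@continuous_FTC2 _ _ (fun y : R => k.+1%:R^-1 * sin (k.+1%:R * y)))//=.
- rewrite mulrN sinN.
  have -> : sin (k.+1%:R * pi) = 0 :> R.
    elim: k {k0 dF cF} => [|k IH]; first by rewrite mul1r sinpi.
    by rewrite -natr1 mulrDl mul1r sinDpi IH oppr0.
  by rewrite oppr0 mulr0 subee.
- apply: continuous_subspaceT => x.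
  by apply: continuous_comp; [exact: mulrl_continuous|exact: continuous_cos].
- split; [by move=> x _; exact: ex_derive|exact/cvg_at_right_filter/cF|exact/cvg_at_left_filter/cF].
- by move=> x _; rewrite derive1E; exact: derive_val.
Qed.

Lemma integral_sinn (R : realType) (k : nat) :
  (\int[lebesgue_measure]_(x in `[(- pi)%R, (pi : R)%R]) (sin (k%:R * x))%:E)%E = 0%E.
Proof.
have pipi : - pi < pi :> R by have := pi_gt0 R; lra.
case: k => [|k].
  by under eq_integral do rewrite mul0r sin0; rewrite integral0.
have k0 : k.+1%:R != 0 :> R by rewrite pnatr_eq0.
pose F (y : R) := - k.+1%:R^-1 * cos (k.+1%:R * y).
have dF (x : R) : is_derive x 1 F (sin (k.+1%:R * x)).
  by apply: is_derive_eq; rewrite /GRing.scale/=; field.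
have cF : continuous F.
  by move=> x; apply/differentiable_continuous/derivable1_diffP; exact: ex_derive.
rewrite (@continuous_FTC2 _ _ F)//=.
- by rewrite /F mulrN cosN subee.
- apply: continuous_subspaceT => x.
  by apply: continuous_comp; [exact: mulrl_continuous|exact: continuous_sin].
- split; [by move=> x _; exact: ex_derive|exact/cvg_at_right_filter/cF|exact/cvg_at_left_filter/cF].
- by move=> x _; rewrite derive1E; exact: derive_val.
Qed.

Lemma integrable_itv_continuous (R : realType) (a b : R) (u : R -> R) :
  continuous u -> lebesgue_measure.-integrable `[a, b] (EFin \o u).
Proof.
move=> cu; apply: continuous_compact_integrable; first exact: segment_compact.
exact: continuous_subspaceT.
Qed.

Lemma continuous_cosn (R : realType) (k : nat) : continuous (fun x : R => cos (k%:R * x)).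
Proof.
by move=> x; apply: continuous_comp; [exact: mulrl_continuous|exact: continuous_cos].
Qed.

Lemma continuous_sinn (R : realType) (k : nat) : continuous (fun x : R => sin (k%:R * x)).
Proof.
by move=> x; apply: continuous_comp; [exact: mulrl_continuous|exact: continuous_sin].
Qed.

Lemma integral_trig_sum (R : realType) (a b : nat -> R) (n : nat) :
  let u x := \sum_(i < n.+1) (a i * cos (i%:R * x) + b i * sin (i%:R * x)) in
  lebesgue_measure.-integrable `[- pi, pi : R]%classic (EFin \o u) /\
  (\int[lebesgue_measure]_(x in `[(- pi)%R, (pi : R)%R]) (u x)%:E)%E = (2 * pi * a 0%N)%:E.
Proof.
move=> u; pose I : set R := `[- pi, pi]%classic; rewrite -/I.
have mI : measurable I by exact: measurable_itv.
have ic k c : lebesgue_measure.-integrable I (fun x => c%:E * (cos (k%:R * x))%:E)%E.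
  by apply: integrableZl => //; exact: (integrable_itv_continuous R (- pi) pi _ (continuous_cosn R k)).
have is_ k c : lebesgue_measure.-integrable I (fun x => c%:E * (sin (k%:R * x))%:E)%E.
  by apply: integrableZl => //; exact: (integrable_itv_continuous R (- pi) pi _ (continuous_sinn R k)).
have one k : lebesgue_measure.-integrable I (fun x => (a k * cos (k%:R * x) + b k * sin (k%:R * x))%:E)%E /\
  (\int[lebesgue_measure]_(x in I) (a k * cos (k%:R * x) + b k * sin (k%:R * x))%:E = ((2 * pi * a k) *+ (k == 0)%N)%:E)%E.
  split.
    under [X in integrable _ _ X]eq_fun do rewrite EFinD !EFinM.
    exact: integrableD.
  under eq_integral do rewrite EFinD !EFinM.
  rewrite integralD//= !integralZl//=.
  - rewrite integral_cosn integral_sinn mule0 adde0 -EFinM; congr EFin.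
    by case: (k == 0)%N; rewrite ?mulr1n ?mulr0n ?mulr0//; ring.
  - exact: (integrable_itv_continuous R (- pi) pi _ (continuous_sinn R k)).
  - exact: (integrable_itv_continuous R (- pi) pi _ (continuous_cosn R k)).
rewrite /u {u}; elim: n => [|n [IH1 IH2]] /=.
  have [h1 h2] := one 0%N; split.
    by under [X in integrable _ _ X]eq_fun do rewrite /= big_ord1.
  by under eq_integral do rewrite big_ord1.
have [h1 h2] := one n.+1.
split.
  under [X in integrable _ _ X]eq_fun do rewrite /= big_ord_recr /= EFinD.
  exact: integrableD.
under eq_integral do rewrite big_ord_recr /= EFinD.
by rewrite integralD//= IH2 h2 mulr0n adde0.
Qed.

Lemma integral_trig (u : R -> R) (m : R) : trig_mean u m ->
  leb.-integrable Lam (EFin \o u) /\ (\int[leb]_(x in Lam) (u x)%:E)%E = (2 * pi * m)%:E.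
Proof.
move=> [A [uA <-]].
(* One term more than [size A], so that the sum is nonempty even for [A = 0]. *)
have -> : u = (fun x => \sum_(i < (size A).+1) (Re A`_i * cos (i%:R * x) + Im A`_i * sin (i%:R * x))).
  apply/funext => x; rewrite uA (@horner_coef_wide _ (size A).+1)// Re_sum.
  by apply: eq_bigr => i _; rewrite Re_mul_zetaX.
exact: (integral_trig_sum R (fun i => Re A`_i) (fun i => Im A`_i)).
Qed.

(** * Trigonometric approximation of Riemann integrable functions *)

(** The classical iteration of p + (x^2 - p^2) / 2 from p = 0, whose values approach |x| from below
    on [-1, 1]. *)
Fixpoint abs_poly (n : nat) : {poly R} :=
  if n is k.+1 then abs_poly k + 2^-1 *: ('X^2 - abs_poly k ^+ 2) else 0.

(* The last bound gives [|x| - p_n(x) <= 2 / n]. *)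
Lemma abs_poly_bound (n : nat) (x : R) : `|x| <= 1 ->
  [/\ 0 <= (abs_poly n).[x], (abs_poly n).[x] <= `|x| &
      (`|x| - (abs_poly n).[x]) * (2 + n%:R * `|x|) <= 2 * `|x|].
Proof.
move=> x1; have x0 := normr_ge0 x.
elim: n => [|n [IH0 IH1 IH2]]; first by rewrite horner0; split=> //; rewrite subr0 mul0r addr0 mulrC.
rewrite /= !hornerE -(real_normK (num_real x)).
move: (`|x|) ((abs_poly n).[x]) x0 x1 IH0 IH1 IH2 => t p t0 t1 p0 pt H.
have n0 : 0 <= n%:R :> R by [].
(* Each step multiplies the error by 1 - (t + p) / 2, which is at most 1 - t / 2. *)
have E : t - (p + 2^-1 * (t ^+ 2 - p ^+ 2)) = (t - p) * (1 - 2^-1 * (t + p)) by ring.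
have q0 : 0 <= 1 - 2^-1 * (t + p) by lra.
have q1 : 1 - 2^-1 * (t + p) <= 1 - 2^-1 * t by lra.
split.
- by rewrite addr_ge0// mulr_ge0// subr_ge0 ler_sqr ?nnegrE.
- by rewrite -subr_ge0 E mulr_ge0// subr_ge0.
- rewrite E -[n.+1%:R]natr1; apply: (@le_trans _ _ ((t - p) * (1 - 2^-1 * t) * (2 + (n%:R + 1) * t))).
    by rewrite ler_wpM2r ?ler_wpM2l ?subr_ge0// addr_ge0// mulr_ge0// addr_ge0.
  apply: le_trans H; rewrite -mulrA ler_wpM2l ?subr_ge0//.
  rewrite -subr_ge0.
  have -> : 2 + n%:R * t - (1 - 2^-1 * t) * (2 + (n%:R + 1) * t) = 2^-1 * (n%:R + 1) * t ^+ 2.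
    by field.
  by rewrite mulr_ge0 ?sqr_ge0// mulr_ge0 ?invr_ge0// addr_ge0.
Qed.

Lemma normr_poly_approx (B e : R) : 0 < B -> 0 < e ->
  exists p : {poly R}, forall x, `|x| <= B -> `| `|x| - p.[x]| <= e.
Proof.
move=> B0 e0; have [n nP] : exists n : nat, 2 * B / e <= n.+1%:R.
  by exists (Num.truncn (2 * B / e)); apply/ltW/truncnS_gt.
exists (B%:P * (abs_poly n.+1 \Po (B^-1 *: 'X))) => x xB.
have yB : `|B^-1 * x| <= 1 by rewrite normrM gtr0_norm ?invr_gt0// ler_pdivrMl// mulr1.
have [p0 p1 p2] := abs_poly_bound n.+1 _ yB.
rewrite hornerCM horner_comp hornerZ hornerX.
move: (abs_poly n.+1).[B^-1 * x] p0 p1 p2 => p p0 p1 p2.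
have -> : `|x| = B * `|B^-1 * x|.
  by rewrite normrM gtr0_norm ?invr_gt0// mulrA mulfV ?gt_eqF// mul1r.
move: (`|B^-1 * x|) (normr_ge0 (B^-1 * x)) p1 p2 yB => t t0 p1 p2 t1.
rewrite -mulrBr normrM gtr0_norm// ger0_norm ?subr_ge0//.
have n0 : 0 < n.+1%:R :> R by [].
have : (t - p) * n.+1%:R <= 2.
  (* At t = 0 the bound [p2] is vacuous, but there the error is at most 0. *)
  move: t0; rewrite le_eqVlt => /orP[/eqP t0|t0].
    have tp : t - p <= 0 by lra.
    by apply: le_trans (_ : 0 <= _) => //; rewrite mulr_le0_ge0// ltW.
  rewrite -(ler_pM2r t0) -mulrA; apply: le_trans p2.
  by rewrite ler_wpM2l ?subr_ge0// lerDr.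
rewrite ler_pdivrMr// in nP.
move=> h; rewrite -(ler_pM2r n0); apply: le_trans (_ : B * 2 <= _).
  by rewrite -mulrA ler_pM2l.
by rewrite mulrC (mulrC e).
Qed.

(** The clamping of [y] to [0, 1], expressed by absolute values so that [normr_poly_approx] turns it
    into a polynomial. *)
Definition clip01 (y : R) : R := 2^-1 * (`|y| - `|y - 1| + 1).

Lemma clip01_le1 (y : R) : clip01 y <= 1.
Proof. by rewrite /clip01; have := ler_normD (y - 1) 1; rewrite subrK normr1; lra. Qed.

Lemma clip01_ge0 (y : R) : 0 <= clip01 y.
Proof. by rewrite /clip01; have := ler_normB y 1; rewrite normr1; lra. Qed.

Lemma clip01_0 (y : R) : y <= 0 -> clip01 y = 0.
Proof.
by move=> y0; rewrite /clip01 ler0_norm// ler0_norm; [ring|lra].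
Qed.

Lemma clip01_1 (y : R) : 1 <= y -> clip01 y = 1.
Proof.
by move=> y1; rewrite /clip01 ger0_norm ?ger0_norm; [field|lra|lra].
Qed.

(** The function w(x) = K (cos (x - m) - cos r) is at most 0 at distance at least r from m, and at
    least 1 within r - eta. Clamping it to [0, 1] gives a bump. Polynomial approximation of the two
    absolute values costs e / 2, and subtracting another e / 2 keeps the result below the bump. *)
Lemma trig_bump (m r eta e : R) : 0 < eta -> eta < r -> - pi <= m - r -> m + r <= pi -> 0 < e ->
  exists u M, [/\ trig_mean u M,
    forall x, Lam x -> u x <= (m - r < x < m + r)%R%:R &
    forall x, Lam x -> (m - r + eta <= x <= m + r - eta)%R%:R - e <= u x].
Proof.
move=> eta0 etar mr1 mr2 e0.
have rpi : r <= pi by lra.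
have kap : cos r < cos (r - eta).
  by rewrite ltr_cos// ?in_itv/=; lra.
pose K := (cos (r - eta) - cos r)^-1.
have K0 : 0 < K by rewrite invr_gt0 subr_gt0.
have B0 : 0 < 2 * K + 1 by lra.
have e2 : 0 < e / 2 by lra.
have [p hp] := normr_poly_approx _ _ B0 e2.
pose lin : {poly R} := K *: ('X - (cos r)%:P).
pose P : {poly R} := 2^-1 *: ((p \Po lin) - (p \Po (lin - 1)) + 1) - (e / 2)%:P.
pose w x := K * (cos (x - m) - cos r).
have wB x : `|w x| <= 2 * K + 1 /\ `|w x - 1| <= 2 * K + 1.
  have /andP[c1 c2] : - 2 <= cos (x - m) - cos r <= 2.
    have := cos_le1 (x - m); have := cos_geN1 (x - m); have := cos_le1 r; have := cos_geN1 r; lra.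
  have : w x <= K * 2 by rewrite ler_pM2l.
  have : K * - 2 <= w x by rewrite ler_pM2l.
  by split; rewrite ler_norml; lra.
have clipP x : clip01 (w x) - e <= P.[cos (x - m)] <= clip01 (w x).
  have [/hp h1 /hp h2] := wB x; move: h1 h2; rewrite !ler_norml /clip01 /P /lin.
  rewrite !hornerE !horner_comp !hornerE -/(w x).
  move: (p.[w x]) (p.[w x - 1]) (`|w x|) (`|w x - 1|) => a b c d; lra.
have [M hM] := trig_horner_cos m P.
exists (fun x => P.[cos (x - m)]), M; split=> // x; rewrite /Lam /= in_itv/= => /andP[x1 x2].
  have /andP[_ h] := clipP x; apply: (le_trans h).
  case: (boolP (m - r < x < m + r)) => [_|out]; first exact: clip01_le1.
  rewrite clip01_0//; apply: mulr_ge0_le0; first exact: ltW.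
  rewrite subr_le0 -(cos_norm (x - m)).
  (* Since [m - r, m + r] lies in [Lam], the distance to m modulo 2 pi is still at least r;
     distances above pi are folded back by periodicity. *)
  have xm : `|x - m| <= 2 * pi - r /\ r <= `|x - m|.
    move: out; rewrite negb_and -!leNgt => /orP[ho|ho].
      by rewrite ler0_norm; lra.
    by rewrite ger0_norm; lra.
  have r0 : 0 < r by lra.
  have [y1|y1] := leP `|x - m| pi.
    by rewrite leNgt ltr_cos ?in_itv/= -?leNgt; lra.
  have -> : cos `|x - m| = cos (2 * pi - `|x - m|).
    rewrite -[RHS]cosN opprB -[in RHS](@cosD2pi _ (`|x - m| - 2 * pi)).
    by congr cos; ring.
  by rewrite leNgt ltr_cos ?in_itv/= -?leNgt; lra.
have /andP[h _] := clipP x; apply: le_trans h; suff : (m - r + eta <= x <= m + r - eta)%R%:R <= clip01 (w x) by lra.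
case: (boolP (m - r + eta <= x <= m + r - eta)) => [inn|_]; last exact: clip01_ge0.
rewrite clip01_1 // /w ler_pdivlMl; last by rewrite subr_gt0.
rewrite mulr1 lerD2r -(cos_norm (x - m)).
have y1 : `|x - m| <= r - eta by rewrite ler_norml; lra.
have y0 := normr_ge0 (x - m).
by rewrite leNgt ltr_cos ?in_itv/= -?leNgt; lra.
Qed.

Lemma integral_ge_indic (R : realType) (u : R -> R) (a b p q e : R) : a <= p -> p <= q -> q <= b ->
  lebesgue_measure.-integrable `[a, b]%classic (EFin \o u) ->
  (forall x, a <= x <= b -> (p <= x <= q)%R%:R - e <= u x) ->
  ((q - p - (b - a) * e)%:E <= \int[lebesgue_measure]_(x in `[a, b]%classic) (u x)%:E)%E.
Proof.
move=> ap pq qb iu low; have ab : a <= b by rewrite (le_trans ap)// (le_trans pq).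
pose L := `[a, b]%classic : set R; rewrite -/L.
have mL : measurable L by exact: measurable_itv.
pose I := `[p, q]%classic : set R.
have mI : measurable I by exact: measurable_itv.
have mu_itv (c d : R) : c <= d -> lebesgue_measure `[c, d]%classic = (d - c)%:E.
  move=> cd; rewrite lebesgue_measure_itv /= lte_fin.
  case: ifPn => [_|]; first by rewrite -EFinB.
  by rewrite -leNgt => dc; congr EFin; apply/eqP; rewrite eq_sym subr_eq0 eq_le dc cd.
have IL : I `<=` L.
  move=> x; rewrite /I /L /= !in_itv/= => /andP[x1 x2].
  by rewrite (le_trans ap x1) (le_trans x2 qb).
have ie : lebesgue_measure.-integrable L (EFin \o cst (- e)).
  exact: (integrable_itv_continuous R a b (fun=> - e) (fun _ => cvg_cst _)).
have i1 : lebesgue_measure.-integrable L (EFin \o \1_I).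
  have h : lebesgue_measure.-integrable [set: R] (EFin \o \1_I) := integrable_indic_itv p q true false.
  exact: integrableS h.
rewrite (_ : (q - p - (b - a) * e)%:E = (\int[lebesgue_measure]_(x in L) (\1_I x + - e)%:E)%E).
  apply: le_integral => //.
    by under eq_fun do rewrite /= EFinD; exact: integrableD.
  move=> x Lx; rewrite lee_fin; apply: le_trans (low x _); last by rewrite inE /L /= in_itv/= in Lx.
  by rewrite indicE mem_setE in_itv.
under eq_integral do rewrite EFinD.
rewrite integralD//= integral_indic// setIidl// integral_cst// /I /L [X in (_ = X + _)%E](mu_itv _ _ pq) [X in (_ * X)%E](mu_itv _ _ ab) -EFinM -EFinD; congr EFin; ring.
Qed.

Lemma trig_below_itv (a b e : R) : - pi <= a -> a < b -> b <= pi -> 0 < e ->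
  exists u M, [/\ trig_mean u M, forall x, Lam x -> u x <= (a < x < b)%R%:R &
    b - a - e <= 2 * pi * M].
Proof.
move=> pa ab bp e0; have pi0 := pi_gt0 R.
(* Shrinking the interval costs 2 eta <= e / 2, and the error e / (4 pi) of the bump costs e / 2
   over the length 2 pi. The second bound ensures eta < r. *)
pose eta := Num.min (e / 4) ((b - a) / 4); pose m := (a + b) / 2; pose r := (b - a) / 2.
have eta1 : eta <= e / 4 by rewrite ge_min lexx.
have eta2 : eta <= (b - a) / 4 by rewrite ge_min lexx orbT.
have eta0 : 0 < eta by rewrite lt_min; apply/andP; split; lra.
have e'0 : 0 < e / (4 * pi) by rewrite divr_gt0// mulr_gt0.
have ma : m - r = a by rewrite /m /r; field.
have mb : m + r = b by rewrite /m /r; field.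
have [] := trig_bump m r eta (e / (4 * pi)) eta0 _ _ _ e'0; rewrite ?ma ?mb//; first by rewrite /r; lra.
move=> u [M [hu up low]]; exists u, M; split=> //.
have [iu Eu] := integral_trig _ _ hu.
have low' x : - pi <= x <= pi -> (a + eta <= x <= b - eta)%R%:R - e / (4 * pi) <= u x.
  by move=> xpi; apply: low; rewrite /Lam /= in_itv.
have [g1 g2 g3] : [/\ - pi <= a + eta, a + eta <= b - eta & b - eta <= pi] by split; lra.
have := integral_ge_indic R u (- pi) pi _ _ _ g1 g2 g3 iu low'.
rewrite [X in (_ <= X)%E]Eu lee_fin.
have -> : (pi - - pi) * (e / (4 * pi)) = e / 2 by field; lra.
lra.
Qed.

(** Sum of bumps below the open pieces, by induction on the subdivision. The value of [s] at a
    breakpoint is arbitrary; nonnegativity of [s] suffices there because no bump is positive at such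
    a point. *)
Lemma trig_below_step (s : R -> R) (I e : R) : has_step_int (- pi) pi s I ->
  (forall x, Lam x -> 0 <= s x) -> 0 < e ->
  exists u M, [/\ trig_mean u M, forall x, Lam x -> u x <= s x & I - e <= 2 * pi * M].
Proof.
have pi0 := pi_gt0 R; move=> hs s0 e0.
have ab : - pi <= pi :> R by lra.
have [l [lf [hl ->]]] := step_int_ex_couple _ _ _ _ ab hs.
(* For the induction the left end becomes variable and [s] is cut to 0 to its left. *)
suff H : forall (l lf : list R) (a : R), - pi <= a -> a <= pi -> adapted_couple s a pi l lf ->
  forall e : R, 0 < e -> exists u M, [/\ trig_mean u M,
    forall x, Lam x -> u x <= if a <= x then s x else 0 & Int_SF lf l - e <= 2 * pi * M].
  have [u [M [h1 h2 h3]]] := H _ _ _ (lexx _) ab hl _ e0.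
  exists u, M; split=> // x Lx; apply: (le_trans (h2 x Lx)).
  by move: Lx; rewrite /Lam /= in_itv/= => /andP[-> _].
clear l lf hl e e0 hs I; elim=> [|r1 l IH] lf a pa ap hl e e0.
  by case: hl => _ [_ [_ []]].
case: l IH hl => [|r2 l] IH hl.
  case: lf hl => [|v lf] hl; last by case: hl => _ [_ [_ []]].
  exists (fun=> 0), 0; split; [exact: trig_cst| |by rewrite /= mulr0 subr_le0 ltW].
  by move=> x Lx; case: ifP => // _; exact: s0.
case: lf hl => [|v lf] hl; first by case: hl => _ [_ [_ []]].
have r1a : r1 = a by case: hl => _ [/= -> _]; rewrite RminE min_l.
subst r1.
have hl2 := StepFun_P7 (RleP ap) hl.
have ar2 : a <= r2.
  by case: hl => h _; have /RleP := h 0%N (PeanoNat.Nat.lt_0_succ _).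
have r2p : r2 <= pi.
  have [h1 [_ [h2 _]]] := hl; have := RList_P7 _ r2 h1 (or_intror (or_introl erefl)).
  by rewrite h2 RmaxE max_r// => /RleP.
have [e2 pr2] : 0 < e / 2 /\ - pi <= r2 by split; lra.
have [u [M [h1 h2 h3]]] := IH _ _ pr2 r2p hl2 _ e2.
(* A subdivision may repeat a point; a degenerate piece contributes nothing. *)
move: ar2; rewrite le_eqVlt => /orP[/eqP ar2|ar2].
  exists u, M; split=> // [x Lx|].
    by rewrite ar2; exact: h2.
  by move: h3; rewrite /= RplusE RmultE RminusE ar2 subrr mulr0 add0r; lra.
have sv x : a < x < r2 -> s x = v.
  move=> /andP[x1 x2]; case: hl => _ [_ [_ [_ h]]].
  by apply: (h 0%N (PeanoNat.Nat.lt_0_succ _)); split; apply/RltP.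
have v0 : 0 <= v.
  rewrite -(sv ((a + r2) / 2)); last by rewrite !midf_lt.
  by apply: s0; rewrite /Lam /= in_itv/=; lra.
have ev : 0 < e / (2 * (v + 1)) by rewrite divr_gt0// mulr_gt0// ltr_wpDl.
have [t [N [k1 k2 k3]]] := trig_below_itv a r2 _ pa ar2 r2p ev.
exists (fun x => v * t x + u x), (v * N + M); split.
- exact/trig_add/h1/trig_scale.
- move=> x Lx; have := h2 x Lx; have := k2 x Lx => kx hx.
  have [xa|xa] := ltP x a.
    have [xr xa'] : (r2 <= x) = false /\ (a < x) = false by rewrite !leNgt; lra.
    move: kx hx; rewrite xa' xr => /= kx hx.
    by have := ler_wpM2l v0 kx; rewrite mulr0; lra.
  have [xr|xr] := ltP x r2.
    move: hx; rewrite [r2 <= x]leNgt xr /= => hx.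
    have : v * t x <= s x.
      have [x1|x1] := ltP a x.
        by rewrite (sv x) ?x1// ler_piMr// (le_trans kx)// x1 xr.
      apply: le_trans (s0 x Lx); move: kx; rewrite ltNge x1 /= => kx.
      by have := ler_wpM2l v0 kx; rewrite mulr0.
    lra.
  move: kx hx; rewrite xr [x < r2]ltNge xr andbF /= => kx hx.
  by have := ler_wpM2l v0 kx; rewrite mulr0; lra.
- rewrite /= RplusE RmultE RminusE.
  have := ler_wpM2l v0 k3; have : v * (e / (2 * (v + 1))) <= e / 2.
    rewrite -subr_ge0 (_ : _ - _ = e / (2 * (v + 1))); last by field; lra.
    exact: ltW.
  by nra.
Qed.

(** Clamp p - s <= g <= p + s to [-C, C]. Then max (p - s, -C) + C and C - min (p + s, C) are
    nonnegative step functions, and [trig_below_step] gives a minorant of each, hence [u] and [v].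
    The total loss is at most 2 J + e / 2 < e. *)
Lemma RI_trig_sandwich (g : R -> R) (C e : R) : RI (- pi) pi g ->
  (forall x, Lam x -> `|g x| <= C) -> 0 < e ->
  exists u v M N, [/\ trig_mean u M, trig_mean v N,
    forall x, Lam x -> u x <= g x <= v x & 2 * pi * N <= 2 * pi * M + e].
Proof.
have pi0 := pi_gt0 R; have ab : - pi <= pi :> R by lra.
move=> hg gC e0; have e4 : 0 < e / 4 by lra.
have [p [s [I [J [h1 h2 Je gps]]]]] := hg _ e4.
have {}gps x : Lam x -> `|g x - p x| <= s x.
  by rewrite /Lam /= in_itv/= => h; exact: gps.
have hm := step_int_add _ _ _ _ _ _ h1 (step_int_opp _ _ _ _ h2).
have hp := step_int_add _ _ _ _ _ _ h1 h2.
have [K1 k1] := step_int_map2 (fun x y => Num.max (x - y) (- C) + C) _ _ _ _ _ _ h1 h2.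
have [K2 k2] := step_int_map2 (fun x y => C - Num.min (x + y) C) _ _ _ _ _ _ h1 h2.
have [|u [M [u1 u2 u3]]] := trig_below_step _ _ _ k1 _ e4.
  by move=> x _; rewrite -lerBlDr sub0r le_max lexx orbT.
have [|v [N [v1 v2 v3]]] := trig_below_step _ _ _ k2 _ e4.
  by move=> x _; rewrite subr_ge0 ge_min lexx orbT.
exists (fun x => u x + - C), (fun x => C + - v x), (M + - C), (C + - N); split.
- exact: trig_add (trig_cst _).
- exact: trig_add (trig_cst _) (trig_opp _ _ _).
- move=> x Lx; have := u2 x Lx; have := v2 x Lx; have := gps x Lx; have := gC x Lx.
  rewrite !ler_norml => /andP[c1 c2] /andP[g1 g2] vx ux.
  have m1 : Num.max (p x - s x) (- C) <= g x by rewrite ge_max c1 andbT; lra.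
  have m2 : g x <= Num.min (p x + s x) C by rewrite le_min c2 andbT; lra.
  by apply/andP; split; lra.
- have K1I : I - J + C * (pi - - pi) <= K1.
    apply: (step_int_le _ _ _ _ _ _ ab _ (step_int_add _ _ _ _ _ _ hm (step_int_cst _ _ C)) k1).
    by move=> x _; rewrite lerD2r le_max lexx.
  have K2I : C * (pi - - pi) - (I + J) <= K2.
    apply: (step_int_le _ _ _ _ _ _ ab _ (step_int_add _ _ _ _ _ _ (step_int_cst _ _ C) (step_int_opp _ _ _ _ hp)) k2).
    by move=> x _; rewrite lerD2l lerN2 ge_min lexx.
  lra.
Qed.

(** * Polynomials of small modulus with prescribed value at the origin *)

Lemma csq_zeta (x : R) : csq (zeta x) = 1.
Proof. by rewrite /csq /= sqrrN cos2Dsin2. Qed.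

Lemma csq_horner_bounded (A : {poly R[i]}) : exists K : R, forall x, csq A.[zeta x] <= K.
Proof.
elim/poly_ind : A => [|A c [K hK]].
  by exists 0 => x; rewrite horner0 /csq /= expr0n addr0.
exists (2 * K + 2 * csq c) => x; rewrite hornerMXaddC.
have : csq (A.[zeta x] * zeta x) <= K by rewrite csqM csq_zeta mulr1.
case: (A.[zeta x] * zeta x) c => [a b] [s t]; rewrite /csq /=.
have := sqr_ge0 (a - s); have := sqr_ge0 (b - t); nra.
Qed.

Lemma outer_poly (u : R -> R) (M e : R) : trig_mean u M -> 0 < e ->
  exists p : {poly R[i]}, p`_0 = 1 /\ forall x, csq p.[zeta x] <= expR (u x - M + e).
Proof.
move=> [A [uA <-]] e0; pose h : R[i] := Complex 2^-1 0.
(* Halved so that 2 Re B is [u] minus its mean; B(0) = 0 makes p(0) = 1 below. *)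
pose B := h%:P * (A - (A`_0)%:P).
have B0 : B.[0] = 0 by rewrite !hornerE horner_coef0 subrr mulr0.
have ReB x : 2 * Re B.[zeta x] = u x - Re A`_0.
  rewrite uA !hornerE; case: (A.[zeta x]) => a b; case: (A`_0) => c d /=.
  by field.
clearbody B; have [K hK] := csq_horner_bounded B.
have K0 : 0 <= K := le_trans (csq_ge0 _) (hK 0).
(* The quadratic terms |B|^2 / L^2 add up to at most K / L in the exponent after the L-th power;
   this choice makes that at most e. *)
have [n nP] : exists n : nat, K / e <= n.+1%:R.
  by exists (Num.truncn (K / e)); apply/ltW/truncnS_gt.
set L := n.+1%:R : R in nP; have L0 : 0 < L by rewrite /L.
pose l : R[i] := Complex L^-1 0.
exists ((1 + l%:P * B) ^+ n.+1); split.
  by rewrite -horner_coef0 !hornerE B0 mulr0 addr0 expr1n.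
move=> x; rewrite horner_exp csqX !hornerE.
have := ReB x; have := hK x; case: (B.[zeta x]) => a b hab ua.
have le1 : csq (1 + l * Complex a b) <= expR (L^-1 * (u x - Re A`_0) + K / L ^+ 2).
  apply: le_trans (expR_ge1Dx _); rewrite -ua.
  have -> : csq (1 + l * Complex a b) = 1 + (L^-1 * (2 * a) + csq (Complex a b) / L ^+ 2).
    by rewrite /csq /=; field; lra.
  by rewrite lerD2l lerD2l ler_wpM2r// invr_ge0 sqr_ge0.
apply: (@le_trans _ _ (expR (L^-1 * (u x - Re A`_0) + K / L ^+ 2) ^+ n.+1)).
  by rewrite lerXn2r// nnegrE ?csq_ge0// expR_ge0.
rewrite -expRM_natl ler_expR mulrDr -/L mulrA mulfV ?gt_eqF// mul1r lerD2l.
have -> : L * (K / L ^+ 2) = K / L by field; lra.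
by rewrite ler_pdivrMr// mulrC -ler_pdivrMr.
Qed.

(** * Prediction errors as an extremal problem for polynomials *)

(* No measurable structure is inferred from the bare Stdlib type [R]. *)
Local Notation measR D u := (@measurable_fun _ _ (measurableTypeR R) (measurableTypeR R) D u).

Lemma measurable_Lam : @measurable _ (measurableTypeR R) Lam.
Proof. exact: measurable_itv. Qed.

Lemma integrable_measurable (u : R -> R) : leb.-integrable Lam (EFin \o u) -> measR Lam u.
Proof. by move=> /measurable_int /measurable_EFinP. Qed.

Lemma measurable_trig (u : R -> R) (m : R) : trig_mean u m -> measR Lam u.
Proof. by move=> /integral_trig[/integrable_measurable]. Qed.

Lemma measurable_csq (P : {poly R[i]}) : measR Lam (fun x => csq P.[zeta x]).
Proof.
apply: measurable_funD; apply: measurable_funX.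
  by apply: (@measurable_trig _ (Re P`_0)); exists P.
(* Multiplication by -i turns the imaginary part into a real part. *)
pose Q := (Complex 0 (-1))%:P * P.
apply: (@measurable_trig _ (Re Q`_0)); exists Q; split=> // x.
by rewrite /Q hornerM hornerC; case: (P.[zeta x]) => a b /=; ring.
Qed.

#[export] Instance ae_leb_filter : Filter (nbhs (almost_everywhere leb)).
Proof. exact: (ae_filter_ringOfSetsType (@lebesgue_measure R)). Qed.

Definition poly_err (f : R -> R) (P : {poly R[i]}) : \bar R :=
  (\int[leb]_(x in Lam) (csq P.[zeta x] * f x)%:E)%E.

(** The prediction coefficients are the negated coefficients of [P]. The imaginary parts then differ
    in sign, which the square removes. *)
Lemma csq_trig_err2 (n : nat) (P : {poly R[i]}) (x : R) : (size P <= n.+1)%N -> P`_0 = 1 ->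
  csq P.[zeta x] = trig_err2 n (fun k => - Re P`_k) (fun k => - Im P`_k) x.
Proof.
move=> sP P0; rewrite (horner_coef_wide _ sP) -(big_mkord xpredT (fun i => P`_i * zeta x ^+ i)).
rewrite big_ltn// P0 expr0 mulr1 /csq ReD ImD Re_sum Im_sum /= add0r /trig_err2.
congr (_ ^+ 2 + _).
  by rewrite -sumrN; congr (_ + _); apply: eq_bigr => k _; rewrite Re_mul_zetaX; ring.
rewrite -[in RHS]sqrrN -sumrN; congr (_ ^+ 2).
by apply: eq_bigr => k _; rewrite Im_mul_zetaX; ring.
Qed.

Lemma trig_err2_poly (n : nat) (a b : nat -> R) :
  exists P : {poly R[i]}, [/\ (size P <= n.+1)%N, P`_0 = 1 &
    forall x, trig_err2 n a b x = csq P.[zeta x]].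
Proof.
pose P : {poly R[i]} := \poly_(i < n.+1) (if i == 0%N then 1 else Complex (- a i) (- b i)).
have P0 : P`_0 = 1 by rewrite coef_poly.
exists P; split=> //; first exact: size_poly.
move=> x; rewrite (csq_trig_err2 n)//; last exact: size_poly.
rewrite /trig_err2; congr ((1 - _) ^+ 2 + _ ^+ 2); apply: eq_big_nat => k /andP[k0 kn];
  by rewrite /P coef_poly kn -[k == _]negbK -lt0n k0 /= !opprK.
Qed.

(** The infimum before [fine], so that lattice lemmas for extended reals apply; [sigma2_EFin] shows
    that nothing is lost for integrable [f]. *)
Definition poly_inf (f : R -> R) (n : nat) : \bar R :=
  ereal_inf [set poly_err f P | P in [set P : {poly R[i]} | (size P <= n.+1)%N /\ P`_0 = 1]].

Lemma sigma2_poly_inf (f : R -> R) (n : nat) : sigma2 f n = fine (poly_inf f n).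
Proof.
congr (fine (ereal_inf _)); apply/seteqP; split=> [_ [[a b] _ <-]|_ [P [sP P0] <-]] /=.
  have [P [sP P0 E]] := trig_err2_poly n a b; exists P => //.
  by apply: eq_integral => x _; rewrite E.
exists (fun k => - Re P`_k, fun k => - Im P`_k) => //.
by apply: eq_integral => x _; rewrite /= -csq_trig_err2.
Qed.

Lemma poly_err_ge0 (f : R -> R) (P : {poly R[i]}) : nonneg_L1 f -> (0 <= poly_err f P)%E.
Proof. by move=> [f0 _]; apply: integral_ge0 => x Lx; rewrite lee_fin mulr_ge0 ?csq_ge0 ?f0. Qed.

Lemma sigma2_EFin (f : R -> R) (n : nat) : nonneg_L1 f -> (sigma2 f n)%:E = poly_inf f n.
Proof.
move=> fL; rewrite sigma2_poly_inf fineK// ge0_fin_numE; last first.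
  by apply: le_ereal_inf_tmp => _ [P _ <-]; exact: poly_err_ge0.
(* The constant polynomial 1 is admissible and has the finite error given by the integral of [f]. *)
apply: (@le_lt_trans _ _ (poly_err f 1)).
  by apply: ereal_inf_lbound; exists 1 => //; split; rewrite ?size_poly1// coef1.
case: fL => f0 fi; rewrite /poly_err; under eq_integral do rewrite hornerC csq1 mul1r.
by have := integrable_fin_num measurable_Lam fi; rewrite fin_numE ltey => /andP[].
Qed.

Lemma sigma2_le (f : R -> R) (n : nat) (P : {poly R[i]}) : nonneg_L1 f ->
  (size P <= n.+1)%N -> P`_0 = 1 -> ((sigma2 f n)%:E <= poly_err f P)%E.
Proof. by move=> fL sP P0; rewrite sigma2_EFin//; apply: ereal_inf_lbound; exists P. Qed.

Lemma le_sigma2 (f : R -> R) (n : nat) (c : R) : nonneg_L1 f ->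
  (forall P : {poly R[i]}, (size P <= n.+1)%N -> P`_0 = 1 -> (c%:E <= poly_err f P)%E) ->
  c <= sigma2 f n.
Proof.
by move=> fL H; rewrite -lee_fin sigma2_EFin//; apply: le_ereal_inf_tmp => _ [P [sP P0] <-]; exact: H.
Qed.

Lemma sigma2_ge0 (f : R -> R) (n : nat) : nonneg_L1 f -> 0 <= sigma2 f n.
Proof. by move=> fL; apply: le_sigma2 => // P _ _; exact: poly_err_ge0. Qed.

Lemma sigma2_decr (f : R -> R) (m n : nat) : nonneg_L1 f -> (m <= n)%N ->
  sigma2 f n <= sigma2 f m.
Proof.
move=> fL mn; apply: le_sigma2 => // P sP P0; apply: sigma2_le => //.
by rewrite (leq_trans sP).
Qed.

Lemma measurable_csq_mul (f : R -> R) (P : {poly R[i]}) : nonneg_L1 f ->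
  measR Lam (fun x => csq P.[zeta x] * f x).
Proof.
move=> [_ fi]; apply: measurable_funM; first exact: measurable_csq.
exact: integrable_measurable.
Qed.

Lemma sigma2_comparison (f fh : R -> R) (p : {poly R[i]}) (c : R) (d n : nat) :
  nonneg_L1 f -> nonneg_L1 fh -> p`_0 = 1 -> (size p <= d.+1)%N -> 0 <= c ->
  {ae leb, forall x, Lam x -> c * csq p.[zeta x] * f x <= fh x} ->
  c * sigma2 f (n + d) <= sigma2 fh n.
Proof.
move=> fL fhL p0 sp c0 H; apply: le_sigma2 => // Q sQ Q0.
have sQp : (size (Q * p)%R <= (n + d).+1)%N.
  apply: (leq_trans (size_polyMleq _ _)).
  have := leq_add sQ sp; case: (size Q + size p)%N => //= k.
  by rewrite addSn addnS.
have Qp0 : (Q * p)`_0 = 1 by rewrite coef0M Q0 p0 mulr1.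
have := sigma2_le f (n + d) (Q * p) fL sQp Qp0 => /(@lee_wpmul2l _ c%:E c0) h.
rewrite EFinM; apply: (le_trans h); rewrite /poly_err -ge0_integralZl//; last 3 first.
- exact: measurable_Lam.
- by apply/measurable_EFinP; exact: measurable_csq_mul.
- by move=> x Lx; rewrite lee_fin mulr_ge0 ?csq_ge0//; case: fL => f0 _; exact: f0.
apply: ae_ge0_le_integral => //.
- exact: measurable_Lam.
- move=> x Lx; rewrite lee_fin mulr_ge0// mulr_ge0 ?csq_ge0//; case: fL => f0 _; exact: f0.
- apply/measurable_EFinP; apply: measurable_funM => //; exact: measurable_csq_mul.
- by move=> x Lx; rewrite lee_fin mulr_ge0 ?csq_ge0//; case: fhL => f0 _; exact: f0.
- by apply/measurable_EFinP; exact: measurable_csq_mul.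
apply: filterS H => x h1 Lx; rewrite lee_fin; have := h1 Lx.
move/(ler_wpM2l (csq_ge0 Q.[zeta x])); apply: le_trans.
by rewrite hornerM csqM le_eqVlt; apply/orP; left; apply/eqP; ring.
Qed.

(** * Ratios of sequences *)

(** The quotient telescopes into d consecutive ratios, each tending to 1. *)
Lemma cvg_ratio_shift (R : realType) (s : nat -> R) (d : nat) : (forall n, 0 < s n) ->
  (fun n => s n.+1 / s n) @ \oo --> (1 : R) -> (fun n => s (n + d)%N / s n) @ \oo --> (1 : R).
Proof.
move=> s0 s1; elim: d => [|d IH].
  under eq_fun do rewrite addn0 divff ?gt_eqF//; exact: cvg_cst.
have -> : (fun n => s (n + d.+1)%N / s n) =
    (fun n => (s (n + d).+1 / s (n + d)%N) * (s (n + d)%N / s n)).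
  by apply/funext => n; rewrite addnS mulrA divfK ?gt_eqF.
rewrite -[1](mulr1 1); apply: cvgM => //.
by move: s1; rewrite -(cvg_shiftn d).
Qed.

Lemma cvg_ratio_expR (R : realType) (s t : nat -> R) (l : R) :
  (forall n, 0 < s n) -> (fun n => s n.+1 / s n) @ \oo --> (1 : R) ->
  (forall e : R, 0 < e -> exists d, forall n, expR (l - e) * s (n + d)%N <= t n) ->
  (forall e : R, 0 < e -> exists d, forall n, expR (- l - e) * t (n + d)%N <= s n) ->
  (fun n => t n / s n) @ \oo --> expR l.
Proof.
move=> s0 s1 lo up; apply/cvgrPdist_le => eps eps0.
have [e e0 he] : exists2 e, 0 < e & expR l - eps < expR (l - e) /\ expR (l + e) < expR l + eps.
  have /cvgrPdist_lt/(_ _ eps0)/nbhs_ballP[e /= e0 he] := @continuous_expR R l.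
  have e2 : 0 < e / 2 by lra.
  have h1 : `|expR l - expR (l - e / 2)| < eps.
    by apply: he; rewrite /ball/= opprB addrC subrK gtr0_norm//; lra.
  have h2 : `|expR l - expR (l + e / 2)| < eps.
    by apply: he; rewrite /ball/= opprD addrA subrr sub0r normrN gtr0_norm//; lra.
  by exists (e / 2) => //; move: h1 h2; rewrite !ltr_norml => /andP[? ?] /andP[? ?]; lra.
have [d1 hd1] := lo _ e0; have [d2 hd2] := up _ e0.
have c1 : (fun n => expR (l - e) * (s (n + d1)%N / s n)) @ \oo --> expR (l - e).
  by rewrite -[X in _ --> X]mulr1; apply: cvgM; [exact: cvg_cst|exact: cvg_ratio_shift].
have c2 : (fun n => expR (l + e) * (s (n + d2)%N / s n)^-1) @ \oo --> expR (l + e).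
  have -> : expR (l + e) = expR (l + e) * 1^-1 by rewrite invr1 mulr1.
  rewrite {1}invr1 mulr1; apply: cvgM; first exact: cvg_cst.
  by apply: cvgV; [rewrite oner_eq0|exact: cvg_ratio_shift].
have low : \forall n \near \oo, expR l - eps <= t n / s n.
  have : \forall n \near \oo, expR l - eps < expR (l - e) * (s (n + d1)%N / s n).
    by apply: cvgr_gt c1 _ _; case: he.
  apply: filterS => n h; apply: (le_trans (ltW h)).
  by rewrite mulrA ler_pM2r ?invr_gt0.
have upp : \forall n \near \oo, t n / s n <= expR l + eps.
  (* The hypothesis bounds [t] at the shifted index, so the estimate is proved there and shifted
     back. *)
  suff [N _ hN] : \forall n \near \oo, t (n + d2)%N / s (n + d2)%N <= expR l + eps.
    exists (N + d2)%N => // n /= Nn; have := hN (n - d2)%N.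
    rewrite subnK; last by rewrite (leq_trans (leq_addl N d2)).
    by apply; rewrite /= leq_subRL ?(leq_trans (leq_addl N d2))// addnC.
  have : \forall n \near \oo, expR (l + e) * (s (n + d2)%N / s n)^-1 < expR l + eps.
    by apply: cvgr_lt c2 _ _; case: he.
  apply: filterS => n h; apply: le_trans (ltW h).
  rewrite invf_div mulrA ler_pM2r ?invr_gt0//.
  have := hd2 n; rewrite -opprD expRN => h'.
  by rewrite -ler_pdivrMl ?expR_gt0.
near=> n; rewrite distrC ler_norml.
have h1 : expR l - eps <= t n / s n by near: n.
have h2 : t n / s n <= expR l + eps by near: n.
by lra.
Unshelve. all: by end_near. Qed.

Lemma cvg_ratio_transfer (R : realType) (s t : nat -> R) (c : R) : c != 0 ->
  (forall n, 0 < s n) -> (forall n, 0 < t n) ->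
  (fun n => s n.+1 / s n) @ \oo --> (1 : R) -> (fun n => t n / s n) @ \oo --> c ->
  (fun n => t n.+1 / t n) @ \oo --> (1 : R).
Proof.
move=> c0 s0 t0 s1 tc.
have -> : (fun n => t n.+1 / t n) =
    (fun n => ((t n.+1 / s n.+1) * (s n.+1 / s n)) * (t n / s n)^-1).
  apply/funext => n; have := s0 n; have := s0 n.+1; have := t0 n => p q r.
  by field; rewrite !gt_eqF.
rewrite -(divff c0) -[c in c / _]mulr1; apply: cvgM; last exact: cvgV.
by apply: cvgM => //; move: tc; rewrite -cvg_shiftS.
Qed.

Lemma cvg_sqrt_ratio (R : realType) (t : nat -> R) : (forall n, 0 < t n) ->
  (fun n => t n.+1 / t n) @ \oo --> (1 : R) ->
  (fun n => Num.sqrt (t n.+1) / Num.sqrt (t n)) @ \oo --> (1 : R).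
Proof.
move=> t0 t1; have -> : (fun n => Num.sqrt (t n.+1) / Num.sqrt (t n)) =
    (fun n => Num.sqrt (t n.+1 / t n)).
  by apply/funext => n; rewrite sqrtrM ?ltW// sqrtrV// ltW.
rewrite -sqrtr1; apply: continuous_cvg => //; exact: sqrt_continuous.
Qed.

Lemma cvg_sqr_ratio (R : realType) (t : nat -> R) : (forall n, 0 <= t n) ->
  (fun n => Num.sqrt (t n.+1) / Num.sqrt (t n)) @ \oo --> (1 : R) ->
  (fun n => t n.+1 / t n) @ \oo --> (1 : R).
Proof.
move=> t0 t1; have -> : (fun n => t n.+1 / t n) =
    (fun n => (Num.sqrt (t n.+1) / Num.sqrt (t n)) * (Num.sqrt (t n.+1) / Num.sqrt (t n))).
  by apply/funext => n; rewrite -expr2 expr_div_n !sqr_sqrtr.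
by rewrite -[1](mulr1 1); apply: cvgM.
Qed.

(* Division by [0] gives [0], so the limit [1] rules out zeros. *)
Lemma ratio_cvg1_gt0 (R : realType) (t : nat -> R) : (forall n, 0 <= t n) ->
  (forall m n, (m <= n)%N -> t n <= t m) ->
  (fun n => t n.+1 / t n) @ \oo --> (1 : R) -> forall n, 0 < t n.
Proof.
move=> t0 td t1 n.
have [N _ hN] : \forall n \near \oo, 0 < t n.+1 / t n by apply: (cvgr_gt _ t1); exact: ltr01.
apply: (lt_le_trans _ (td n (maxn n N) (leq_maxl _ _))).
rewrite lt_def t0 andbT; apply/negP => /eqP E.
by have := hN (maxn n N) (leq_maxr _ _); rewrite /= E invr0 mulr0 ltxx.
Qed.

(** * Measurability and integrals *)

Lemma ae_dominated_integrable d (T : measurableType d) (R : realType) (mu : {measure set T -> \bar R})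
    (D : set T) (f g : T -> \bar R) : measurable D -> measurable_fun D f ->
  mu.-integrable D g -> {ae mu, forall x, D x -> (`|f x| <= `|g x|)%E} -> mu.-integrable D f.
Proof.
move=> mD mf /integrableP[mg gi] fg; apply/integrableP; split=> //.
apply: le_lt_trans gi; apply: ae_ge0_le_integral => //; exact: measurableT_comp.
Qed.

Lemma ae_le_integral d (T : measurableType d) (R : realType) (mu : {measure set T -> \bar R})
    (D : set T) (f g : T -> \bar R) : measurable D ->
  mu.-integrable D f -> mu.-integrable D g -> {ae mu, forall x, D x -> (f x <= g x)%E} ->
  (\int[mu]_(x in D) f x <= \int[mu]_(x in D) g x)%E.
Proof.
move=> mD /integrableP[mf _] /integrableP[mg _] fg; rewrite integralE [leRHS]integralE.
apply: leeB; apply: ae_ge0_le_integral => //; do ?[exact: measurable_funepos|exact: measurable_funeneg].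
- apply: filterS fg => x h /h fgx; rewrite !funeposE ge_max le_max fgx /=.
  by rewrite le_max lexx orbT.
- apply: filterS fg => x h /h fgx; rewrite !funenegE ge_max le_max leeN2 fgx /=.
  by rewrite le_max lexx orbT.
Qed.

Lemma measurable_fun_log_ninfty d (T : measurableType d) (R : realType) (D : set T) (g : T -> R) :
  measurable D -> measurable_fun D g ->
  measurable_fun D (fun x => if 0 < g x then (ln (g x))%:E else -oo%E).
Proof.
move=> mD mg; apply: measurable_fun_if => //.
- by apply: measurable_fun_ltr.
- apply/measurable_EFinP; apply: (measurableT_comp (@measurable_ln R)).
  by apply: measurable_funS mg.
Qed.

Lemma measurable_fun_div d (T : measurableType d) (R : realType) (D : set T) (f g : T -> R) :
  (forall x, D x -> 0 <= g x) ->
  measurable_fun D f -> measurable_fun D g -> measurable_fun D (fun x => f x / g x).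
Proof.
move=> g0 mf mg; apply: measurable_funM => //.
(* The measurable power with exponent -1 agrees with inversion on nonnegative reals, also at 0,
   where both give 0. *)
apply: (eq_measurable_fun (fun x => g x `^ (-1))).
  by move=> x; rewrite inE => Dx; rewrite powR_inv1// g0.
exact: (measurableT_comp (measurable_powR (-1)) mg).
Qed.

(** * The geometric mean *)

Lemma maxr_lipschitz (R : realDomainType) (m a b : R) : `|Num.max a m - Num.max b m| <= `|a - b|.
Proof.
have h : a - b <= `|a - b| by exact: ler_norm.
have h' : - (a - b) <= `|a - b| by rewrite -normrN ler_norm.
have h0 := normr_ge0 (a - b).
by rewrite ler_norml; case: (leP a m); case: (leP b m) => *; apply/andP; split; lra.
Qed.

Lemma ln_lipschitz (R : realType) (m a b : R) : 0 < m -> m <= a -> m <= b ->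
  `|ln a - ln b| <= m^-1 * `|a - b|.
Proof.
move=> m0; wlog ab : a b / a <= b => [H|] ma mb.
  by have [ab|/ltW ba] := leP a b; [exact: H|rewrite distrC (distrC a); exact: H].
have [a0 b0] : 0 < a /\ 0 < b by split; lra.
rewrite distrC (distrC a) ger0_norm; last by rewrite subr_ge0 ler_ln.
rewrite ger0_norm ?subr_ge0// -ln_div ?posrE//.
have -> : b / a = 1 + (b - a) / a by field; lra.
apply: (@le_trans _ _ ((b - a) / a)).
  apply: le_ln1Dx; apply: lt_le_trans (_ : 0 <= _); first lra.
  by rewrite divr_ge0 ?subr_ge0// ltW.
by rewrite mulrC ler_wpM2r ?subr_ge0// lef_pV2// posrE.
Qed.

Lemma inv_lipschitz (R : realFieldType) (m a b : R) : 0 < m -> m <= a -> m <= b ->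
  `|a^-1 - b^-1| <= m ^- 2 * `|a - b|.
Proof.
move=> m0 ma mb; have [a0 b0] : 0 < a /\ 0 < b by split; lra.
have -> : a^-1 - b^-1 = (a * b)^-1 * (b - a) by field; lra.
rewrite normrM (distrC b) ger0_norm; last by rewrite invr_ge0 mulr_ge0// ltW.
rewrite ler_wpM2r// lef_pV2 ?posrE ?mulr_gt0 ?exprn_gt0// expr2.
by rewrite ler_pM// ltW.
Qed.

(** [ln] is Lipschitz only away from 0; truncating at [m] changes nothing on [a, b] and makes the
    composition globally Lipschitz. [RI_inv] proceeds in the same way. *)
Lemma RI_ln (a b m : R) (h : R -> R) : 0 < m -> (forall x, a <= x <= b -> m <= h x) ->
  RI a b h -> RI a b (fun x => ln (h x)).
Proof.
move=> m0 mh hh; apply: (@RI_ext _ _ (fun x => ln (Num.max (h x) m))).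
  by move=> x /mh hx; rewrite max_l.
apply: (RI_lipschitz (fun y => ln (Num.max y m)) m^-1) hh; first by rewrite invr_ge0 ltW.
move=> x y; apply: le_trans (ln_lipschitz _ _ _ _ m0 _ _) _; rewrite ?le_max ?lexx ?orbT//.
by rewrite ler_wpM2l ?maxr_lipschitz// invr_ge0 ltW.
Qed.

Lemma RI_inv (a b m : R) (h : R -> R) : 0 < m -> (forall x, a <= x <= b -> m <= h x) ->
  RI a b h -> RI a b (fun x => (h x)^-1).
Proof.
move=> m0 mh hh; apply: (@RI_ext _ _ (fun x => (Num.max (h x) m)^-1)).
  by move=> x /mh hx; rewrite max_l.
have K0 : 0 <= m ^- 2 by rewrite invr_ge0 exprn_ge0// ltW.
apply: (RI_lipschitz (fun y => (Num.max y m)^-1) (m ^- 2)) hh => //.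
move=> x y; apply: le_trans (inv_lipschitz _ _ _ _ m0 _ _) _; rewrite ?le_max ?lexx ?orbT//.
by rewrite ler_wpM2l ?maxr_lipschitz.
Qed.

Lemma measurable_lnE (g : R -> R) : measR Lam g ->
  @measurable_fun _ _ (measurableTypeR R) _ Lam (lnE g).
Proof. by move=> mg; apply: measurable_fun_log_ninfty => //; exact: measurable_Lam. Qed.

Lemma lnE_gt0 (g : R -> R) (x : R) : 0 < g x -> lnE g x = (ln (g x))%:E.
Proof. by rewrite /lnE => ->. Qed.

(** Here [g] stands for the ratio itself and [h] for its Riemann integrable representative. The mean
    l of ln h lies between the means of the two sides of a sandwich, which differ by at most e. *)
Lemma G_log_mean (g h : R -> R) (m M : R) : measR Lam g -> RI (- pi) pi h -> 0 < m ->
  (forall x, Lam x -> m <= h x <= M) -> {ae leb, forall x, Lam x -> g x = h x} ->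
  exists l, [/\ leb.-integrable Lam (lnE g), G g = expR l &
    forall e : R, 0 < e -> exists u v a b, [/\ trig_mean u a, trig_mean v b,
      forall x, Lam x -> u x <= ln (h x) <= v x, l - e <= a & b <= l + e]].
Proof.
have pi0 := pi_gt0 R; move=> mg hR m0 hm gh.
have LE x : Lam x = (- pi <= x <= pi) :> Prop by rewrite /Lam /= in_itv.
have lnR : RI (- pi) pi (fun x => ln (h x)).
  by apply: (RI_ln _ _ m) => // x; rewrite -LE => /hm/andP[].
have lnB x : Lam x -> `|ln (h x)| <= `|ln m| + `|ln M|.
  move=> /hm/andP[h1 h2]; have h0 := lt_le_trans m0 h1.
  have : ln m <= ln (h x) by rewrite ler_ln.
  have : ln (h x) <= ln M by rewrite ler_ln// posrE (lt_le_trans h0).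
  have := ler_norm (ln M); have := ler_norm (- ln m); rewrite normrN => *.
  have := normr_ge0 (ln M); have := normr_ge0 (ln m) => *.
  by rewrite ler_norml; apply/andP; split; lra.
have gln : {ae leb, forall x, Lam x -> lnE g x = (ln (h x))%:E}.
  apply: filterS gh => x H Lx; rewrite lnE_gt0 H//.
  by case/andP : (hm x Lx) => h1 _; exact: lt_le_trans m0 h1.
pose B := `|ln m| + `|ln M|.
have iB := (integral_trig _ _ (trig_cst B)).1.
have ig : leb.-integrable Lam (lnE g).
  apply: ae_dominated_integrable iB _ => //; [exact: measurable_Lam|exact: measurable_lnE|].
  apply: filterS gln => x H Lx; rewrite H//= lee_fin (le_trans (lnB _ Lx))//.
  exact: ler_norm.
pose I := fine (\int[leb]_(x in Lam) lnE g x).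
have EI : (\int[leb]_(x in Lam) lnE g x)%E = I%:E.
  by rewrite fineK// integrable_fin_num//; exact: measurable_Lam.
have w0 : 0 < 2 * pi :> R by rewrite mulr_gt0.
pose J := (2 * pi)^-1 * I.
have GJ : G g = expR J by rewrite /G asboolT.
have IJ : I = 2 * pi * J by rewrite /J mulrA mulfV ?mul1r// gt_eqF.
clearbody J; exists J; split=> //.
move=> e e0; have e'0 : 0 < 2 * pi * e by rewrite !mulr_gt0.
have [u [v [a [b [hu hv uv ab]]]]] := RI_trig_sandwich _ _ _ lnR lnB e'0.
exists u, v, a, b; split=> //.
- have [iv Ev] := integral_trig _ _ hv.
  have : (\int[leb]_(x in Lam) lnE g x <= \int[leb]_(x in Lam) (v x)%:E)%E.
    apply: ae_le_integral => //; first exact: measurable_Lam.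
    by apply: filterS gln => x H Lx; rewrite H//= lee_fin; case/andP: (uv x Lx).
  rewrite EI Ev lee_fin => h1.
  rewrite -(ler_pM2l w0) mulrBr lerBlDr; apply: le_trans ab; apply: le_trans h1.
  by rewrite IJ.
- have [iu Eu] := integral_trig _ _ hu.
  have : (\int[leb]_(x in Lam) (u x)%:E <= \int[leb]_(x in Lam) lnE g x)%E.
    apply: ae_le_integral => //; first exact: measurable_Lam.
    by apply: filterS gln => x H Lx; rewrite H//= lee_fin; case/andP: (uv x Lx).
  rewrite EI Eu lee_fin => h1.
  rewrite -(ler_pM2l w0) [X in _ <= X]mulrDr; apply: (le_trans ab); rewrite lerD2r; apply: (le_trans h1).
  by rewrite IJ.
Qed.

(** * Comparison of prediction errors *)

Lemma sigma2_lower (f fh h u : R -> R) (a e : R) : nonneg_L1 f -> nonneg_L1 fh ->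
  trig_mean u a -> (forall x, Lam x -> 0 < h x) -> (forall x, Lam x -> u x <= ln (h x)) ->
  {ae leb, forall x, Lam x -> fh x = h x * f x} -> 0 < e ->
  exists d, forall n, expR (a - e) * sigma2 f (n + d)%N <= sigma2 fh n.
Proof.
move=> fL fhL hu h0 uh fhE e0; have [p [p0 hp]] := outer_poly u a e hu e0.
(* The degree of [p] is one less; the larger shift is harmless. *)
exists (size p) => n; apply: (sigma2_comparison _ _ p) => //.
apply: filterS fhE => x H Lx; rewrite H// ler_wpM2r//; first by case: fL => + _; apply.
apply: (@le_trans _ _ (expR (a - e) * expR (u x - a + e))).
  by rewrite ler_wpM2l ?expR_ge0.
rewrite -exp.expRD -[leRHS]lnK ?posrE ?h0// ler_expR; apply: le_trans (uh x Lx).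
by rewrite le_eqVlt; apply/orP; left; apply/eqP; ring.
Qed.

Lemma sigma2_ratio (f fh h : R -> R) (m M l : R) : nonneg_L1 f -> nonneg_L1 fh -> 0 < m ->
  (forall x, Lam x -> m <= h x <= M) ->
  {ae leb, forall x, Lam x -> fh x = h x * f x} ->
  (forall e : R, 0 < e -> exists u v a b, [/\ trig_mean u a, trig_mean v b,
      forall x, Lam x -> u x <= ln (h x) <= v x, l - e <= a & b <= l + e]) ->
  (fun n => sigma f n.+1 / sigma f n) @ \oo --> (1 : R) ->
  (fun n => sigma fh n.+1 / sigma fh n) @ \oo --> (1 : R) /\
  (fun n => sigma2 fh n / sigma2 f n) @ \oo --> expR l.
Proof.
move=> fL fhL m0 hm fhE hl s1.
have h0 x : Lam x -> 0 < h x by move=> /hm/andP[h1 _]; exact: lt_le_trans m0 h1.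
have {}s1 : (fun n => sigma2 f n.+1 / sigma2 f n) @ \oo --> (1 : R).
  by apply: (cvg_sqr_ratio R (sigma2 f)) s1 => n; exact: sigma2_ge0.
have s0 : forall n, 0 < sigma2 f n.
  apply: (ratio_cvg1_gt0 R (sigma2 f)) s1 => [n|p q pq]; first exact: sigma2_ge0.
  exact: sigma2_decr.
have lo (e : R) : 0 < e -> exists d, forall n, expR (l - e) * sigma2 f (n + d)%N <= sigma2 fh n.
  move=> e0; have e2 : 0 < e / 2 by lra.
  have [u [v [a [b [hu _ uv la _]]]]] := hl _ e2.
  have [|d hd] := sigma2_lower f fh h u a (e / 2) fL fhL hu h0 _ fhE e2.
    by move=> x /uv/andP[].
  exists d => n; apply: le_trans (hd n); rewrite ler_wpM2r ?sigma2_ge0// ler_expR; lra.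
have fE : {ae leb, forall x, Lam x -> f x = (h x)^-1 * fh x}.
  by apply: filterS fhE => x H Lx; rewrite H// mulrA mulVf ?mul1r// gt_eqF ?h0.
have up (e : R) : 0 < e -> exists d, forall n, expR (- l - e) * sigma2 fh (n + d)%N <= sigma2 f n.
  move=> e0; have e2 : 0 < e / 2 by lra.
  have [u [v [a [b [_ hv uv _ bl]]]]] := hl _ e2.
  have [||d hd] := sigma2_lower fh f (fun x => (h x)^-1) (fun x => - v x) (- b) (e / 2)
      fhL fL (trig_opp _ _ hv) _ _ fE e2.
  - by move=> x Lx; rewrite invr_gt0 h0.
  - by move=> x Lx; rewrite lnV ?posrE ?h0// lerN2; case/andP: (uv x Lx).
  exists d => n; apply: le_trans (hd n); rewrite ler_wpM2r ?sigma2_ge0// ler_expR; lra.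
have ts := cvg_ratio_expR R (sigma2 f) (sigma2 fh) l s0 s1 lo up.
(* Positivity for [fh] is inherited from [f] through the lower bound with e = 1. *)
split=> //; have t0 n : 0 < sigma2 fh n.
  have [d hd] := lo 1 ltr01; apply: lt_le_trans (hd n).
  by rewrite mulr_gt0 ?expR_gt0.
apply: (cvg_sqrt_ratio R (sigma2 fh)) => //.
by apply: (cvg_ratio_transfer R (sigma2 f) (sigma2 fh) (expR l)) => //; rewrite gt_eqF ?expR_gt0.
Qed.

(** Since ln fh = ln g + ln f almost everywhere, |ln g| + |ln f| is an integrable majorant. *)
Lemma lnE_integrable_transfer (f fh g : R -> R) : measR Lam fh ->
  {ae leb, forall x, Lam x -> 0 < f x /\ 0 < g x} ->
  {ae leb, forall x, Lam x -> fh x = g x * f x} ->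
  leb.-integrable Lam (lnE g) -> leb.-integrable Lam (lnE f) -> leb.-integrable Lam (lnE fh).
Proof.
move=> mfh fg0 fhE ig i_f.
have isum : leb.-integrable Lam (fun x => `|lnE g x| + `|lnE f x|)%E.
  by apply: integrableD; [exact: measurable_Lam|exact: integrable_abse|exact: integrable_abse].
apply: ae_dominated_integrable isum _; [exact: measurable_Lam|exact: measurable_lnE|].
apply: filterS2 fg0 fhE => x H1 H2 Lx; have [f0 g0] := H1 Lx.
have fhx := H2 Lx.
rewrite !lnE_gt0//; last by rewrite fhx mulr_gt0.
rewrite /= lee_fin fhx lnM ?posrE// [leRHS]ger0_norm ?addr_ge0//.
exact: ler_normD.
Qed.

(** The exponential never vanishes, so [G] is 0 only through its default branch. *)
Lemma G_eq0 (f : R -> R) : (G f = 0 /\ ~ leb.-integrable Lam (lnE f)) \/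
  (0 < G f /\ leb.-integrable Lam (lnE f)).
Proof.
rewrite /G; case: asboolP => h; [right|left] => //.
by split=> //; exact: expR_gt0.
Qed.

(** * Gluing Riemann integrable functions *)

Lemma minr_lipschitz (R : realDomainType) (m a b : R) : `|Num.min a m - Num.min b m| <= `|a - b|.
Proof.
have h : a - b <= `|a - b| by exact: ler_norm.
have h' : - (a - b) <= `|a - b| by rewrite -normrN ler_norm.
have h0 := normr_ge0 (a - b).
by rewrite ler_norml; case: (leP a m); case: (leP b m) => *; apply/andP; split; lra.
Qed.

Lemma RI_max (a b m : R) (f : R -> R) : RI a b f -> RI a b (fun x => Num.max (f x) m).
Proof.
by apply: (RI_lipschitz (fun y => Num.max y m) 1) => // x y; rewrite mul1r maxr_lipschitz.
Qed.

Lemma RI_min (a b m : R) (f : R -> R) : RI a b f -> RI a b (fun x => Num.min (f x) m).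
Proof.
by apply: (RI_lipschitz (fun y => Num.min y m) 1) => // x y; rewrite mul1r minr_lipschitz.
Qed.

(** Multiplication is Lipschitz only on bounded sets, hence the clamping of both factors to
    [-C, C]. *)
Lemma RI_mul (a b C : R) (f g : R -> R) : 0 <= C ->
  (forall x, a <= x <= b -> `|f x| <= C) -> (forall x, a <= x <= b -> `|g x| <= C) ->
  RI a b f -> RI a b g -> RI a b (fun x => f x * g x).
Proof.
move=> C0 fC gC rf rg; pose cl y := Num.max (Num.min y C) (- C).
have cllip x y : `|cl x - cl y| <= `|x - y|.
  exact: le_trans (maxr_lipschitz _ _ _ _) (minr_lipschitz _ _ _ _).
have clC x : `|cl x| <= C.
  by rewrite ler_norml /cl le_max lexx orbT /= ge_max ge_min lexx orbT /=; lra.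
have cle x : `|x| <= C -> cl x = x.
  by rewrite ler_norml => /andP[h1 h2]; rewrite /cl min_l// max_l.
apply: (@RI_ext _ _ (fun x => cl (f x) * cl (g x))).
  by move=> x xab; rewrite !cle ?fC ?gC.
apply: (RI_lipschitz2 (fun x y => cl x * cl y) C) => // x y x' y'.
have -> : cl x * cl y - cl x' * cl y' = (cl x - cl x') * cl y + cl x' * (cl y - cl y') by ring.
apply: (le_trans (ler_normD _ _)); rewrite !normrM mulrDr; apply: lerD.
  by rewrite mulrC ler_pM.
by rewrite ler_pM.
Qed.

(* The clamping to [[a, b]] changes nothing there and keeps the indicator a step
   function with explicit breakpoints. *)
Definition near_pt (a b d y x : R) : bool := (Num.max a (y - d) <= x <= Num.min b (y + d)).

Lemma near_ptE (a b d y x : R) : a <= x <= b -> near_pt a b d y x = (`|x - y| <= d).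
Proof.
move=> /andP[ax xb]; rewrite /near_pt ge_max le_min ax xb /= ler_norml.
by apply/idP/idP => /andP[? ?]; apply/andP; split; lra.
Qed.

Lemma step_int_near_pt (a b d y : R) : 0 < d -> a <= y <= b ->
  exists2 J, has_step_int a b (fun x => (near_pt a b d y x)%:R) J & J <= 2 * d.
Proof.
move=> d0 /andP[ay yb]; exists (Num.min b (y + d) - Num.max a (y - d)).
  apply: step_int_indic; rewrite ?le_max ?ge_min ?lexx//.
  by rewrite ge_max !le_min; apply/andP; split; apply/andP; split; lra.
have : Num.min b (y + d) <= y + d by rewrite ge_min lexx orbT.
have : y - d <= Num.max a (y - d) by rewrite le_max lexx orbT.
lra.
Qed.

Definition off_pts (a b d : R) (s : seq R) (x : R) : bool :=
  all (fun y => ~~ near_pt a b d y x) s.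

Lemma off_ptsP (a b d : R) (s : seq R) (x : R) : a <= x <= b ->
  reflect (forall y, y \in s -> d < `|x - y|) (off_pts a b d s x).
Proof.
move=> xab; apply: (iffP allP) => H y /H; by rewrite near_ptE// ltNge.
Qed.

Lemma step_int_off_pts (a b d : R) (s : seq R) : 0 < d -> (forall y, y \in s -> a <= y <= b) ->
  exists I, has_step_int a b (fun x => (off_pts a b d s x)%:R) I.
Proof.
move=> d0; elim: s => [|y s IH] ys; first by exists (1 * (b - a)); exact: step_int_cst.
have [|I hI] := IH; first by move=> z zs; rewrite ys// in_cons zs orbT.
have [|J hJ _] := step_int_near_pt a b d y d0; first by rewrite ys ?mem_head.
have [K hK] := step_int_map2 (fun u v => (1 - u) * v) _ _ _ _ _ _ hJ hI.
exists K; rewrite (_ : (fun x => _) = (fun x => (1 - (near_pt a b d y x)%:R) * (off_pts a b d s x)%:R))//.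
by apply/funext => x /=; case: near_pt; rewrite /= ?subrr ?mul0r ?subr0 ?mul1r.
Qed.

(** A sum of indicators of the neighbourhoods: overlaps only enlarge it, so the union itself need
    not be measured. *)
Lemma step_int_cover (a b d : R) (s : seq R) : 0 < d -> (forall y, y \in s -> a <= y <= b) ->
  exists w J, [/\ has_step_int a b w J, J <= (size s)%:R * (2 * d), forall x, 0 <= w x &
    forall x, ~~ off_pts a b d s x -> 1 <= w x].
Proof.
move=> d0; elim: s => [|y s IH] ys.
  by exists (fun=> 0), (0 * (b - a)); split=> //; [exact: step_int_cst|rewrite !mul0r].
have [|w [J [h1 h2 h3 h4]]] := IH; first by move=> z zs; rewrite ys// in_cons zs orbT.
have [|K hK Kd] := step_int_near_pt a b d y d0; first by rewrite ys ?mem_head.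
exists (fun x => (near_pt a b d y x)%:R + w x), (K + J); split.
- exact: step_int_add.
- by rewrite /= -natr1 mulrDl mul1r addrC lerD.
- by move=> x; rewrite addr_ge0.
- move=> x /=; rewrite negb_and negbK => /orP[->|/h4 h]; first by rewrite lerDl.
  by apply: (le_trans h); rewrite lerDr.
Qed.

(** At [x] take [H n] for the first n such that [x] is farther than [d n] from all points of [s].
    Off the neighbourhoods of radius [d n] this glues finitely many integrable functions; inside
    them the error is at most be - al on a set of total length at most 2 |s| d(n). *)
Lemma RI_glue (a b al be : R) (s : seq R) (d : nat -> R) (H : nat -> R -> R) :
  a <= b -> al <= be -> (forall y, y \in s -> a <= y <= b) ->
  (forall n, 0 < d n) -> (forall n, d n.+1 <= d n) -> (forall e : R, 0 < e -> exists n, d n < e) ->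
  (forall n, RI a b (H n)) -> (forall n x, al <= H n x <= be) ->
  exists h, [/\ RI a b h, forall x, al <= h x <= be &
    forall x, a <= x <= b -> x \notin s -> exists n,
      (forall y, y \in s -> d n < `|x - y|) /\ h x = H n x].
Proof.
move=> ab alb ys d0 dd dlim HR Hb.
pose off n x := off_pts a b (d n) s x.
have offS n x : a <= x <= b -> off n x -> off n.+1 x.
  move=> xab /(off_ptsP _ _ _ _ _ xab) h; apply/off_ptsP => // y /h; exact: le_lt_trans.
(* In [a, b] the default [al] is taken exactly at the points of [s]. *)
pose h x := if pselect (exists n, off n x) is left e then H (ex_minn e) x else al.
have hE n x : a <= x <= b -> off n x -> (forall i, (i < n)%N -> ~~ off i x) -> h x = H n x.
  move=> xab on lt_n; rewrite /h; case: pselect => [e|[]]; last by exists n.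
  case: ex_minnP => i oi mi; congr H; apply/eqP; rewrite eqn_leq mi//= leqNgt.
  by apply/negP => /lt_n; rewrite oi.
have hb x : al <= h x <= be.
  by rewrite /h; case: pselect => // ?; rewrite lexx.
have [chi hchi] : exists chi : nat -> R -> R, forall n, [/\ (exists I, has_step_int a b (chi n) I),
    (forall x, chi n x = 0 \/ chi n x = 1) & forall x, chi n x = (off n x)%:R].
  exists (fun n x => (off n x)%:R) => n; split=> //; first exact: step_int_off_pts.
  by move=> x; case: (off n x); [right|left].
(* In the inductive step, a point satisfying [off n.+1] but not [off n] has [n.+1] as its first
   index, so [h] equals [H n.+1] there. *)
have WR n : RI a b (fun x => if off n x then h x else al).
  elim: n => [|n IH].
    have [h1 h2 h3] := hchi 0%N.
    apply: RI_ext (RI_if _ _ _ _ _ h1 h2 (HR 0%N) (RI_cst a b al ab)) => x xab.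
    rewrite h3; case: ifPn => o0; rewrite ?subrr ?subr0 ?mul0r ?mul1r ?addr0 ?add0r//.
    by rewrite (hE 0%N).
  have [h1 h2 h3] := hchi n; have [g1 g2 g3] := hchi n.+1.
  apply: RI_ext (RI_if _ _ _ _ _ h1 h2 IH (RI_if _ _ _ _ _ g1 g2 (HR n.+1) (RI_cst a b al ab))) => x xab.
  rewrite h3 g3; case: ifPn => [on|non]; first by rewrite (offS n x)// subrr mul0r mul1r addr0.
  rewrite subr0 mul0r mul1r add0r.
  case: ifPn => o1; rewrite ?subrr ?subr0 ?mul0r ?mul1r ?addr0 ?add0r//.
  rewrite (hE n.+1)// => i; rewrite ltnS leq_eqVlt => /orP[/eqP->//|lt_in].
  apply: contra non; elim: n i lt_in {IH h1 h2 h3 g1 g2 g3 o1} => // n IH i.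
  by rewrite ltnS leq_eqVlt => /orP[/eqP->|/IH h1 /h1]; exact: offS.
exists h; split=> //.
  apply: RI_squeeze => e e0.
  (* The summand 1 covers an empty [s] and the case al = be. *)
  have K0 : 0 < (be - al) * (size s)%:R * 2 + 1.
    by rewrite ltr_wpDl// !mulr_ge0// subr_ge0.
  have [n dn] := dlim _ (divr_gt0 e0 K0).
  have [w [J [w1 w2 w3 w4]]] := step_int_cover a b (d n) s (d0 n) ys.
  exists (fun x => if off n x then h x else al), (fun x => (be - al) * w x), ((be - al) * J).
  split=> //; first exact: step_int_scale.
    have ba : 0 <= be - al by rewrite subr_ge0.
    apply: (le_lt_trans (ler_wpM2l ba w2)).
    move: dn; rewrite ltr_pdivlMr//; apply: le_lt_trans.
    have := ltW (d0 n); lra.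
  move=> x xab; case: ifPn => [_|no]; first by rewrite subrr normr0 mulr_ge0// subr_ge0.
  have /andP[hx1 hx2] := hb x; rewrite ger0_norm ?subr_ge0//.
  apply: (@le_trans _ _ ((be - al) * 1)); first by rewrite mulr1 lerB.
  by rewrite ler_wpM2l ?subr_ge0// w4.
move=> x xab xs.
have [n on] : exists n, off n x.
  have [e e0 he] : exists2 e, 0 < e & forall y, y \in s -> e <= `|x - y|.
    elim: s xs {ys off offS h hE hb hchi WR chi} => [|y s IH]; first by exists 1.
    rewrite in_cons negb_or => /andP[xy /IH[e e0 he]].
    exists (Num.min e `|x - y|); first by rewrite lt_min e0 normr_gt0 subr_eq0.
    move=> z; rewrite in_cons => /orP[/eqP->|/he zs]; first by rewrite ge_min lexx orbT.
    by rewrite ge_min zs.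
  have [n dn] := dlim _ e0; exists n; apply/off_ptsP => // y /he; exact: lt_le_trans.
have ex : exists n, off n x by exists n.
exists (ex_minn ex); case: ex_minnP => i oi mi; split; first by move: oi => /(off_ptsP _ _ _ _ _ xab).
by apply: hE => // j; rewrite ltnNge; apply: contra => /mi.
Qed.

(** * The ratio of the two densities *)

Lemma ae_notin (s : seq R) : {ae leb, forall x, x \notin s}.
Proof.
elim: s => [|y s IH]; first by apply: filterE.
have ny : {ae leb, forall x, x != y}.
  exists [set y]; split; [exact: measurable_set1|exact: lebesgue_measure_set1|].
  by move=> x /= /negP; rewrite negbK => /eqP.
by apply: filterS2 ny IH => x xy xs; rewrite in_cons negb_or xy.
Qed.

Lemma within_cvg_bounds (R : realType) (A : set R) (r : R -> R) (a l : R) :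
  r x @[x --> within A a^'] --> l -> 0 < l ->
  exists2 d, 0 < d & forall x, A x -> x != a -> `|x - a| < d -> l / 2 <= r x <= 2 * l.
Proof.
move=> rl l0; have l2 : 0 < l / 2 by lra.
move: rl => /cvgrPdist_lt/(_ _ l2).
rewrite /within /dnbhs /= => /nbhs_ballP[d /= d0 hd]; exists d => // x Lx xa xd.
have := hd x; rewrite /ball /= distrC => /(_ xd xa Lx).
by rewrite ltr_norml => /andP[h1 h2]; apply/andP; split; lra.
Qed.

(** Supplies radii for which the lower bounds away from the zeros are assumed. *)
Lemma pos_gap (k : nat) (lam : nat -> R) :
  (forall j : nat, (1 <= j < k)%N -> lam j < lam j.+1) ->
  exists2 d, 0 < d & forall j : nat, (1 <= j < k)%N -> d <= lam j.+1 - lam j.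
Proof.
elim: k => [|k IH] inc; first by exists 1 => // j /andP[].
have [|d d0 hd] := IH; first by move=> j /andP[j1 jk]; rewrite inc// j1 ltnW.
have [k0|k0] := posnP k.
  by exists 1 => // j; rewrite k0 ltnS => /andP[j1 j2]; have := leq_trans j1 j2.
exists (Num.min d (lam k.+1 - lam k)); first by rewrite lt_min d0 subr_gt0 inc// k0 leqnn.
move=> j /andP[j1]; rewrite ltnS leq_eqVlt => /orP[/eqP->|jk].
  by rewrite ge_min lexx orbT.
by rewrite ge_min hd// j1.
Qed.

Lemma uniform_near_bounds (k : nat) (lam c : nat -> R) (r : R -> R) :
  (forall j : nat, (1 <= j <= k)%N -> 0 < c j /\ lim_in_Lam r (lam j) (c j)) ->
  exists d al be, [/\ 0 < d, 0 < al & forall j x, (1 <= j <= k)%N -> Lam x -> x != lam j ->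
    `|x - lam j| < d -> al <= r x <= be].
Proof.
elim: k => [|k IH] H; first by exists 1, 1, 1; split=> // j x /andP[j1 j0]; have := leq_trans j1 j0.
have [|d [al [be [d0 al0 hd]]]] := IH; first by move=> j /andP[j1 jk]; apply: H; rewrite j1 leqW.
have [c0 rl] := H k.+1 (leqnn _); have [e e0 he] := within_cvg_bounds R Lam r _ _ rl c0.
exists (Num.min d e), (Num.min al (c k.+1 / 2)), (Num.max be (2 * c k.+1)); split.
- by rewrite lt_min d0.
- by rewrite lt_min al0 divr_gt0.
- move=> j x /andP[j1]; rewrite leq_eqVlt lt_min => /orP[/eqP->|jk] Lx xj /andP[xd xe].
    by have /andP[h1 h2] := he x Lx xj xe; rewrite ge_min h1 orbT le_max h2 orbT.
  by have /andP[h1 h2] := hd j x (introT andP (conj j1 jk)) Lx xj xd; rewrite ge_min h1 le_max h2.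
Qed.

(** Close to the zeros the limits [c j] bound the ratio from both sides; elsewhere the upper bounds
    of the densities and their essential lower bounds do. With these two-sided bounds [RI_glue]
    applies to truncated ratios. *)
Lemma ratio_representative (f fh : R -> R) (k : nat) (lam c : nat -> R) :
  classBminus f -> classBminus fh ->
  - pi < lam 1%N ->
  (forall j : nat, (1 <= j < k)%N -> lam j < lam j.+1) ->
  lam k <= pi ->
  (forall j : nat, (1 <= j <= k)%N ->
     0 < c j /\ lim_in_Lam (fun x => fh x / f x) (lam j) (c j)) ->
  (forall delta : R, 0 < delta ->
     (forall j : nat, (1 <= j < k)%N -> delta <= lam j.+1 - lam j) ->
     exists m : R, 0 < m /\
       {ae leb, forall x, Lam x ->
          (forall j : nat, (1 <= j <= k)%N -> delta <= `|x - lam j|) ->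
          m <= f x /\ m <= fh x}) ->
  exists h al be, [/\ RI (- pi) pi h, 0 < al, forall x, al <= h x <= be &
    {ae leb, forall x, Lam x -> [/\ 0 < f x, 0 < fh x & h x = fh x / f x]}].
Proof.
have pi0 := pi_gt0 R; have pipi : - pi <= pi :> R by lra.
have LE x : Lam x = (- pi <= x <= pi) :> Prop by rewrite /Lam /= in_itv.
move=> [[f0 fR] [M1 [M10 fM]]] [[fh0 fhR] [M2 [M20 fhM]]] lam1 inc lamk lims low.
have rf := (RI_Riemann_integrable _ _ f pipi).1 fR.
have rfh := (RI_Riemann_integrable _ _ fh pipi).1 fhR.
have [dg dg0 hdg] := pos_gap _ _ inc.
have [dn [al1 [be1 [dn0 al10 hn]]]] := uniform_near_bounds _ _ _ _ lims.
pose d0 := Num.min dg dn.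
have d00 : 0 < d0 by rewrite lt_min dg0.
pose d n := d0 / n.+1%:R.
have dpos n : 0 < d n by rewrite divr_gt0.
have dgap n j : (1 <= j < k)%N -> d n <= lam j.+1 - lam j.
  move=> /hdg; apply: le_trans; apply: (@le_trans _ _ d0); last by rewrite ge_min lexx.
  by rewrite ler_pdivrMr// ler_peMr ?(ltW d00)// ler1n.
have /choice[m hm] : forall n, exists m : R, 0 < m /\
       {ae leb, forall x, Lam x ->
          (forall j : nat, (1 <= j <= k)%N -> d n <= `|x - lam j|) ->
          m <= f x /\ m <= fh x}.
  by move=> n; apply: low => // j; exact: dgap.
have mpos n : 0 < m n by case: (hm n).
(* [al1] and [be1] serve within [d 0] of a zero, the quotients at all other points; the last maximum
   gives al <= be. *)
pose al := Num.min al1 (m 0%N / M1); pose be := Num.max (Num.max be1 (M2 / m 0%N)) al.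
have al0 : 0 < al by rewrite lt_min al10 divr_gt0.
pose s := [seq lam j | j <- iota 1 k].
have inS j : (1 <= j <= k)%N -> lam j \in s.
  by move=> jk; apply: map_f; rewrite mem_iota add1n ltnS.
have sP y : y \in s -> exists2 j, (1 <= j <= k)%N & y = lam j.
  by move=> /mapP[j]; rewrite mem_iota add1n ltnS => jk ->; exists j.
have mono i j : (1 <= i)%N -> (i <= j)%N -> (j <= k)%N -> lam i <= lam j.
  move=> i1; elim: j => [|j IH]; first by rewrite leqn0 => /eqP i0; rewrite i0 in i1.
  rewrite leq_eqVlt => /orP[/eqP->//|ij] jk.
  apply: (le_trans (IH ij (ltnW jk))); apply/ltW/inc.
  by rewrite (leq_trans i1 ij).
have ys y : y \in s -> - pi <= y <= pi.
  move=> /sP[j /andP[j1 jk] ->].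
  by rewrite (le_trans (ltW lam1) (mono _ _ _ j1 jk))// (le_trans (mono _ _ j1 jk (leqnn _)) lamk).
have aeS := ae_notin s.
(* One null set for all n, as there are countably many of them. *)
have ae_all : {ae leb, forall x, forall n, Lam x ->
    (forall j : nat, (1 <= j <= k)%N -> d n <= `|x - lam j|) -> m n <= f x /\ m n <= fh x}.
  by apply: ae_foralln => n; case: (hm n).
have d0E : d 0%N = d0 by rewrite /d divr1.
have near_bd x : Lam x -> x \notin s ->
    (forall n, Lam x -> (forall j : nat, (1 <= j <= k)%N -> d n <= `|x - lam j|) ->
       m n <= f x /\ m n <= fh x) -> al <= fh x / f x <= be.
  move=> Lx xs hx.
  have [far|] := pselect (forall j, (1 <= j <= k)%N -> d 0%N <= `|x - lam j|).
    have [h1 h2] := hx 0%N Lx far; have fx0 := lt_le_trans (mpos 0%N) h1.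
    rewrite /al /be ge_min !le_max; apply/andP; split; apply/orP; [right|left; apply/orP; right].
      rewrite ler_pM ?invr_ge0 ?(ltW (mpos _)) ?(ltW M10)//.
      by rewrite lef_pV2 ?posrE// fM.
    rewrite ler_pM ?invr_ge0 ?(ltW fx0) ?fh0 ?fhM//.
    by rewrite lef_pV2 ?posrE.
  move=> /existsNP[j /not_implyP[jk /negP]]; rewrite -ltNge d0E => xd.
  have xj : x != lam j by apply: contra xs => /eqP->; exact: inS.
  have xdn : `|x - lam j| < dn by apply: (lt_le_trans xd); rewrite ge_min lexx orbT.
  have /andP[h1 h2] := hn j x jk Lx xj xdn.
  by rewrite /al /be ge_min !le_max h1 h2.
(* Truncating the denominator makes the quotient Riemann integrable, and clamping gives bounds
   uniform in n. Almost everywhere at distance at least [d n] from the zeros, neither changes the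
   ratio. *)
pose H n x := Num.max (Num.min (fh x * (Num.max (f x) (m n))^-1) be) al.
have albe : al <= be by rewrite le_max lexx orbT.
have HR n : RI (- pi) pi (H n).
  apply/RI_max/RI_min.
  have C0 : 0 <= Num.max M2 (m n)^-1 by rewrite le_max ltW.
  apply: (RI_mul _ _ _ _ _ C0) => //.
  - by move=> x; rewrite -LE => Lx; rewrite ger0_norm ?fh0// le_max fhM.
  - move=> x _; rewrite ger0_norm; last by rewrite invr_ge0 le_max (ltW (mpos n)) orbT.
    have mf : m n <= Num.max (f x) (m n) by rewrite le_max lexx orbT.
    have mV : (Num.max (f x) (m n))^-1 <= (m n)^-1.
      by rewrite lef_pV2 ?posrE//; exact: lt_le_trans (mpos n) mf.
    by rewrite le_max mV orbT.
  - apply: (RI_inv _ _ (m n)) => //; last exact: RI_max.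
    by move=> x _; rewrite le_max lexx orbT.
have Hb n x : al <= H n x <= be by rewrite /H le_max lexx orbT /= ge_max albe ge_min lexx orbT.
have dd n : d n.+1 <= d n by rewrite /d ler_wpM2l ?(ltW d00)// lef_pV2 ?posrE// ler_nat.
have dlim (e : R) : 0 < e -> exists n, d n < e.
  move=> e0; exists (Num.truncn (d0 / e)); rewrite /d ltr_pdivrMr// mulrC -ltr_pdivrMr//.
  exact: truncnS_gt.
have [h [h1 h2 h3]] := RI_glue _ _ al be s d H pipi albe ys dpos dd dlim HR Hb.
exists h, al, be; split=> //.
apply: filterS2 aeS ae_all => x xs hx Lx.
have xpi : - pi <= x <= pi by rewrite -LE.
have [n [far ->]] := h3 x xpi xs.
have [fm fhm] : m n <= f x /\ m n <= fh x.
  by apply: hx => // j jk; apply/ltW/far/inS.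
split; [exact: lt_le_trans (mpos n) fm|exact: lt_le_trans (mpos n) fhm|].
have /andP[b1 b2] := near_bd x Lx xs hx.
by rewrite /H (max_l fm) min_l// max_l.
Qed.

Bind Scope R_scope with R.

Theorem mainTheorem14 (f fh : R -> R) (k : nat) (lam c : nat -> R) :
  spectral_density f -> spectral_density fh ->
  classBminus f -> classBminus fh ->
  (0 < k)%N ->
  - pi < lam 1%N ->
  (forall j : nat, (1 <= j < k)%N -> lam j < lam j.+1) ->
  lam k <= pi ->
  (forall j : nat, (1 <= j <= k)%N ->
     lim_in_Lam f (lam j) 0 /\ lim_in_Lam fh (lam j) 0) ->
  (forall j : nat, (1 <= j <= k)%N ->
     0 < c j /\ lim_in_Lam (fun x => fh x / f x) (lam j) (c j)) ->
  (forall delta : R, 0 < delta ->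
     (forall j : nat, (1 <= j < k)%N -> delta <= lam j.+1 - lam j) ->
     exists m : R, 0 < m /\
       {ae leb, forall x, Lam x ->
          (forall j : nat, (1 <= j <= k)%N -> delta <= `|x - lam j|) ->
          m <= f x /\ m <= fh x}) ->
  (exists h' : R -> R, classBplusminus h' /\
     {ae leb, forall x, Lam x -> h' x = fh x / f x}) /\
  ((G f = 0 /\ G fh = 0) \/ (0 < G f /\ 0 < G fh)) /\
  (classF f \/ classF fh ->
     classF f /\ classF fh /\ 0 < G (fun x => fh x / f x) /\
     (fun n => sigma2 fh n / sigma2 f n) @ \oo --> G (fun x => fh x / f x)).
Proof.
move=> [fL _] [fhL _] fB fhB _ lam1 inc lamk _ lims low.
have pi0 := pi_gt0 R; have pipi : - pi <= pi :> R by lra.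
have [h [al [be [hR al0 hb hae]]]] := ratio_representative _ _ _ _ _ fB fhB lam1 inc lamk lims low.
have h0 x : 0 < h x by case/andP: (hb x) => h1 _; exact: lt_le_trans al0 h1.
have albe : al <= be by case/andP: (hb 0) => h1 h2; exact: le_trans h1 h2.
have be0 : 0 < be := lt_le_trans al0 albe.
have mf := integrable_measurable _ fL.2; have mfh := integrable_measurable _ fhL.2.
have mg : measR Lam (fun x => fh x / f x) by apply: measurable_fun_div => //; case: fL.
have mg' : measR Lam (fun x => f x / fh x) by apply: measurable_fun_div => //; case: fhL.
have hV x : Lam x -> be^-1 <= (h x)^-1 <= al^-1.
  by move=> _; case/andP: (hb x) => h1 h2; rewrite !lef_pV2 ?posrE ?h0 ?h1 ?h2 ?al0 ?be0.
have hVR : RI (- pi) pi (fun x => (h x)^-1).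
  by apply: (RI_inv _ _ al) => // x _; case/andP: (hb x).
have gh : {ae leb, forall x, Lam x -> fh x / f x = h x}.
  by apply: filterS hae => x H /H[_ _ ->].
have gh' : {ae leb, forall x, Lam x -> f x / fh x = (h x)^-1}.
  by apply: filterS hae => x H /H[_ _ ->]; rewrite invf_div.
have fhE : {ae leb, forall x, Lam x -> fh x = h x * f x}.
  by apply: filterS hae => x H /H[fx _ ->]; rewrite divfK ?gt_eqF.
have fE : {ae leb, forall x, Lam x -> f x = (h x)^-1 * fh x}.
  by apply: filterS fhE => x H /H ->; rewrite mulrA mulVf ?mul1r // gt_eqF.
have [l [ig Gl hl]] := G_log_mean _ _ _ _ mg hR al0 (fun x _ => hb x) gh.
have bV0 : 0 < be^-1 by rewrite invr_gt0.
(* The same for the reciprocal ratio: it yields the converse integrability transfer and the case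
   where [fh] is the density known to lie in [classF]. *)
have [l' [ig' _ hl']] := G_log_mean _ _ _ _ mg' hVR bV0 hV gh'.
have i12 : leb.-integrable Lam (lnE f) -> leb.-integrable Lam (lnE fh).
  apply: lnE_integrable_transfer ig => //; apply: filterS hae => x H /H[fx fhx _].
    by split=> //; exact: divr_gt0.
  by rewrite divfK ?gt_eqF.
have i21 : leb.-integrable Lam (lnE fh) -> leb.-integrable Lam (lnE f).
  apply: lnE_integrable_transfer ig' => //; apply: filterS hae => x H /H[fx fhx _].
    by split=> //; exact: divr_gt0.
  by rewrite divfK ?gt_eqF.
(* The mixed cases contradict the transfer of logarithmic integrability. *)
have GG : (G f = 0 /\ G fh = 0) \/ (0 < G f /\ 0 < G fh).
  case: (G_eq0 f) (G_eq0 fh) => [[? nf]|[? ?]] [[? nfh]|[? ?]]; [by left| | |by right].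
    by case: nf; exact: i21.
  by case: nfh; exact: i12.
split; [|split=> //].
  exists h; split; last by apply: filterS gh => x H /H.
  split; last by exists al, be.
  by split=> [x _|]; [exact: ltW|apply/RI_Riemann_integrable].
move=> FF; have {}FF : classF f /\ classF fh.
  case: FF => -[_ [G0 s1]].
    have [t1 _] := sigma2_ratio _ _ _ _ _ _ fL fhL al0 (fun x _ => hb x) fhE hl s1.
    split=> //; split=> //; split=> //.
    by case: GG => -[G1 G2] //; rewrite G0 ltxx in G1.
  have [t1 _] := sigma2_ratio _ _ _ _ _ _ fhL fL bV0 hV fE hl' s1.
  split=> //; split=> //; split=> //.
  by case: GG => -[G1 G2] //; rewrite G0 ltxx in G2.
(* Whichever density was given, [f] is now in [classF], so the limit is always taken from its side;
   [Gl] identifies expR l with the geometric mean of the actual ratio. *)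
case: FF => Ff Ffh; split=> //; split=> //; rewrite Gl; split; first exact: expR_gt0.
case: Ff => _ [_ s1].
by have [] := sigma2_ratio _ _ _ _ _ _ fL fhL al0 (fun x _ => hb x) fhE hl s1.
Qed.
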